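(* For each $\lambda\in(0,\infty)$, $$\max\{\lambda-1,0\}\le\gamma(\mathcal{B}_H(\lambda))\le\alpha(\lambda),\qquad \alpha(\lambda)=\frac{\sqrt{1+4\lambda^2}-1}{2}.$$ In particular, $\gamma(\mathcal{B}_H(\lambda))=O(\lambda^2)$ as $\lambda\to0$.
   Context: $\mathbb{D}$ is the open unit disk. $\mathcal{H}$ is the class of harmonic mappings $f=h+\overline g$ in $\mathbb{D}$ ($h,g$ analytic) with $h(0)=g(0)=h'(0)-1=0$. $\|T_f\|=\sup_{z\in\mathbb{D},\ \theta\in[0,2\pi]}(1-|z|^2)\left|\frac{h''(z)+e^{i\theta}g''(z)}{h'(z)+e^{i\theta}g'(z)}\right|$, with $\|T_f\|=\infty$ if $h'+e^{i\theta}g'$ has a zero in $\mathbb{D}$ for some $\theta$; and $\mathcal{B}_H(\lambda)=\{f\in\mathcal{H}:\|T_f\|\le 2\lambda\}$. For a harmonic mapping $f(z)=\sum_{n=1}^\infty a_nz^n+\sum_{n=1}^\infty\overline{b_n}\,\overline z^n$ in $\mathbb{D}$ with $a_1=1$ and $b_1=0$, $\gamma(f)$ denotes the infimum of exponents $\gamma$ such that $|a_n|+|b_n|=O(n^{\gamma-1})$ as $n\to\infty$, that is, $\gamma(f)=\limsup_{n\to\infty}\frac{\log\big(n(|a_n|+|b_n|)\big)}{\log n}$. For a subset $X\subset\mathcal{H}$, $\gamma(X)=\sup\gamma(f)$, the supremum being over those $f\in X$ for which $\gamma(f)$ is defined (i.e. with $b_1=0$). *)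

(* Defs.v *)
From Stdlib Require Export Reals ClassicalEpsilon.
From Coquelicot Require Export Coquelicot.
Open Scope R_scope.

Definition in_disk (z : C) : Prop := Cmod z < 1.

(* Complex differentiability: [C_AbsRing] is the field of scalars. *)
Definition analytic_on_disk (h : C -> C) : Prop :=
  forall z : C, in_disk z -> @ex_derive C_AbsRing C_NormedModule h z.

(* [f = h + conj g] on the disk, with [h(0) = g(0) = h'(0) - 1 = 0]; these
   conditions determine [h] and [g] on the disk.
   [C_derive] is computed from a limit along horizontal increments; it is the
   complex derivative at every point where the latter exists, in particular on
   the whole disk for an analytic function and for its derivatives. *)
Definition canonical_decomposition (f h g : C -> C) : Prop :=
  analytic_on_disk h /\ analytic_on_disk g /\
  (forall z : C, in_disk z -> f z = (h z + Cconj (g z))%C) /\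
  h (RtoC 0) = RtoC 0 /\ g (RtoC 0) = RtoC 0 /\
  C_derive h (RtoC 0) = RtoC 1.

Definition expi (theta : R) : C := (cos theta, sin theta).

Definition pS_den (h g : C -> C) (theta : R) (z : C) : C :=
  (C_derive h z + expi theta * C_derive g z)%C.

Definition pS_num (h g : C -> C) (theta : R) (z : C) : C :=
  (C_derive (C_derive h) z + expi theta * C_derive (C_derive g) z)%C.

(* The pre-Schwarzian norm of [h + conj g], with values in [0, +oo]. *)
Definition pre_Schwarzian_norm (h g : C -> C) : Rbar :=
  if excluded_middle_informative
       (exists (theta : R) (z : C), in_disk z /\ pS_den h g theta z = RtoC 0)
  then p_infty
  else Lub_Rbar (fun x : R =>
         exists (z : C) (theta : R),
           in_disk z /\ 0 <= theta <= 2 * PI /\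
           x = (1 - Cmod z ^ 2) *
               Cmod (pS_num h g theta z / pS_den h g theta z)%C).

Definition B_H (lambda : R) (f : C -> C) : Prop :=
  exists h g : C -> C,
    canonical_decomposition f h g /\
    Rbar_le (pre_Schwarzian_norm h g) (Finite (2 * lambda)).

(* [f(z) = sum_(n >= 1) a_n z^n + sum_(n >= 1) conj(b_n) conj(z)^n] on the disk,
   with [a_1 = 1] and [b_1 = 0]. The second sum is the conjugate of
   [sum b_n z^n]. *)
Definition normalized_expansion (f : C -> C) (a b : nat -> C) : Prop :=
  a 0%nat = RtoC 0 /\ b 0%nat = RtoC 0 /\
  a 1%nat = RtoC 1 /\ b 1%nat = RtoC 0 /\
  forall z : C, in_disk z ->
    exists s t : C,
      @is_pseries C_AbsRing C_NormedModule a z s /\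
      @is_pseries C_AbsRing C_NormedModule b z t /\
      f z = (s + Cconj t)%C.

(* Infimum of the real [gamma] with [|a_n| + |b_n| = O(n^(gamma - 1))]; it may
   be infinite, e.g. [m_infty] for the coefficients of [f(z) = z]. *)
Definition growth_exponent (a b : nat -> C) : Rbar :=
  Glb_Rbar (fun gamma : R =>
    exists K : R,
      eventually (fun n : nat =>
        Cmod (a n) + Cmod (b n) <= K * Rpower (INR n) (gamma - 1))).

(* A relation and not a function, because [gamma(f)] is undefined when
   [b_1 <> 0]; the coefficients, hence [x], are determined by [f]. *)
Definition is_gamma (f : C -> C) (x : Rbar) : Prop :=
  exists a b : nat -> C, normalized_expansion f a b /\ x = growth_exponent a b.

Definition gamma_class (X : (C -> C) -> Prop) : Rbar :=
  Rbar_lub (fun x : Rbar => exists f : C -> C, X f /\ is_gamma f x).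

Definition alpha (lambda : R) : R := (sqrt (1 + 4 * lambda ^ 2) - 1) / 2.

(* Main.v *)
Require Import Defs.
From Stdlib Require Import Reals Lra Lia.
From Coquelicot Require Import Coquelicot.

(** Upper bound.  Let [f = h + conj g] lie in the class, with coefficients
    [a n], [b n].  A function that is both analytic and antianalytic is
    constant, so the two power series of [f] are [h] and [g] themselves.
    Since [|a n| + |b n| <= |a n + b n| + |a n - b n|], it is enough to bound
    the coefficients of [F = h + e g] for [e = 1] and [e = -1], the values of
    [e^(i theta)] at [theta = 0] and [theta = PI].  Put [phi = F'], which has no
    zero, so that [|phi|] is smooth, and let [U s] be the integral of [|phi|]
    over the circle of radius [e^s].  In the coordinates [s + i t = log z] the
    Laplacian of [|phi|] is [|z phi'|^2 / |phi|], and its [t]-part integrates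
    to zero over a period, whence
      [U'' s = RInt |z phi'|^2 / |phi|
             <= lambda^2 / sinh(s)^2 * U s <= lambda^2 / s^2 * U s].
    The function [(-s)^(-alpha)] with [alpha (alpha + 1) = lambda^2] solves the
    corresponding equation, and a Wronskian comparison gives
    [U s = O((-s)^(-alpha))] ([mean_growth]).  The [n]-th coefficient of [phi]
    is at most [e^(-n s) U s / (2 PI)] ([coefficient_le_mean]); at [s = - 1 / n]
    this is [O(n^alpha)], so the coefficients of [F] are [O(n^(alpha - 1))].

    Lower bound.  Both examples are analytic ([g = 0]) and are given by the power
    series of [h'].  The condition [(1 - |z|) |h''| <= lambda |h'|] puts such a
    function in the class: it bounds the norm because [1 + |z| <= 2], and it
    forbids zeros of [h'] by Gronwall's inequality on rays
    ([analytic_example]).  For [lambda > 1] take [h' = (1 - z)^(-lambda)], whose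
    coefficients are of order [n^(lambda - 1)].  For every [lambda], take
    [h' = 1 + sum e n z^n] with [e n >= 0] of sum less than 1, supported on the powers
    of two, and of order [1 / m^2] at [n = 2^m]: [n a n] decays more slowly than
    any negative power of [n] along this subsequence, so the exponent is at
    least [0].

    The last claim follows from [alpha lambda <= lambda^2]. *)

Notation is_derive_C := (@is_derive C_AbsRing C_NormedModule).
Notation is_Cseries := (@is_series C_AbsRing C_NormedModule).
Notation is_Cpseries := (@is_pseries C_AbsRing C_NormedModule).

(** * Complex differentiability *)

(** Used in both directions: to prove that power series are differentiable, and
    to compose analytic functions with real curves, where the two sides have
    different scalar fields. *)
Lemma is_derive_C_eps (f : C -> C) (z d : C) :
  is_derive_C f z d <->
  forall eps, 0 < eps -> exists delta, 0 < delta /\ forall w : C, Cmod w < delta ->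
    Cmod (f (z + w) - f z - d * w)%C <= eps * Cmod w.
Proof.
  split.
  - intros [_ H] eps Heps.
    destruct (H z (fun P HP => HP) (mkposreal eps Heps)) as [del Hd].
    exists del; split; [apply cond_pos|].
    intros w Hw.
    specialize (Hd (z + w)%C).
    unfold ball in Hd; simpl in Hd. unfold AbsRing_ball in Hd.
    unfold abs, minus, plus, opp, scal, norm in Hd; simpl in Hd.
    unfold abs, mult in Hd; simpl in Hd.
    replace (z + w + - z)%C with w in Hd by ring.
    replace (f (z + w) - f z - d * w)%C with (f (z + w)%C + - f z + - (w * d))%C by ring.
    exact (Hd Hw).
  - intros H. split; [apply is_linear_scal_l|].
    intros x Hx eps.
    rewrite <- (is_filter_lim_locally_unique _ _ Hx).
    destruct (H eps (cond_pos eps)) as [del [Hdel Hd]].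
    exists (mkposreal del Hdel). intros y Hy.
    unfold ball in Hy; simpl in Hy. unfold AbsRing_ball in Hy.
    unfold abs, minus, plus, opp, scal, norm in *; simpl in *.
    unfold abs, mult; simpl.
    specialize (Hd (y + - z)%C Hy).
    replace (z + (y + - z))%C with y in Hd by ring.
    replace (f y + - f z + - ((y + - z) * d))%C with (f y - f z - d * (y + - z))%C by ring.
    exact Hd.
Qed.

(** * Complex series *)

Lemma Cmod_le_Re_Im (z : C) : Cmod z <= Rabs (Re z) + Rabs (Im z).
Proof.
  replace z with (RtoC (Re z) + Ci * RtoC (Im z))%C at 1
    by (destruct z; unfold Ci, RtoC, Cplus, Cmult, Re, Im; simpl; f_equal; ring).
  eapply Rle_trans; [apply Cmod_triangle|].
  rewrite Cmod_mult, Cmod_Ci, !Cmod_R. lra.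
Qed.

Lemma im_le_Cmod (z : C) : Rabs (Im z) <= Cmod z.
Proof. eapply Rle_trans; [|apply Rmax_Cmod]. apply Rmax_r. Qed.

Lemma sum_n_Re (u : nat -> C) n :
  Re (@sum_n C_NormedModule u n) = sum_n (fun k => Re (u k)) n.
Proof.
  induction n. now rewrite !sum_O.
  rewrite !sum_Sn, <- IHn. reflexivity.
Qed.

Lemma sum_n_Im (u : nat -> C) n :
  Im (@sum_n C_NormedModule u n) = sum_n (fun k => Im (u k)) n.
Proof.
  induction n. now rewrite !sum_O.
  rewrite !sum_Sn, <- IHn. reflexivity.
Qed.

Lemma is_Cseries_components (u : nat -> C) (l : C) :
  is_Cseries u l <->
  is_series (fun n => Re (u n)) (Re l) /\ is_series (fun n => Im (u n)) (Im l).
Proof.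
  unfold is_series. split.
  - intros H. split; apply filterlim_locally; intros eps;
    destruct (proj1 (filterlim_locally _ _) H eps) as [N HN];
    exists N; intros n Hn; destruct (HN n Hn) as [H1 H2].
    + rewrite <- sum_n_Re. exact H1.
    + rewrite <- sum_n_Im. exact H2.
  - intros [H1 H2]. apply filterlim_locally; intros eps.
    destruct (proj1 (filterlim_locally _ _) H1 eps) as [N1 HN1].
    destruct (proj1 (filterlim_locally _ _) H2 eps) as [N2 HN2].
    exists (max N1 N2). intros n Hn. split.
    + specialize (HN1 n ltac:(lia)). rewrite <- sum_n_Re in HN1. exact HN1.
    + specialize (HN2 n ltac:(lia)). rewrite <- sum_n_Im in HN2. exact HN2.
Qed.

Lemma is_series_Cmult_l (c : C) (u : nat -> C) (l : C) :
  is_Cseries u l -> is_Cseries (fun n => (c * u n)%C) (c * l)%C.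
Proof. exact (is_series_scal_l (V := C_NormedModule) c u l). Qed.

Lemma is_series_ge_0 (v : nat -> R) (m : R) :
  is_series v m -> (forall n, 0 <= v n) -> 0 <= m.
Proof.
  intros Hv H. refine (is_lim_seq_le (fun _ => 0) _ 0 m _ (is_lim_seq_const 0) Hv).
  intros n. rewrite <- (Rmult_0_r (INR (S n))), <- sum_n_const. apply sum_n_m_le; auto.
Qed.

(** Multiplying by such an [e] reduces bounds on the modulus of a sum or of an
    integral to bounds on its real part. *)
Lemma unimodular_rotation (l : C) : exists e : C, Cmod e = 1 /\ (e * l)%C = RtoC (Cmod l).
Proof.
  destruct (Req_dec (Cmod l) 0) as [H0|H0].
  - exists (RtoC 1). split; [apply Cmod_1|]. rewrite Cmult_1_l, H0. now apply Cmod_eq_0.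
  - assert (Hc : RtoC (Cmod l) <> 0) by (intros E; apply H0; injection E; auto).
    exists (Cconj l / Cmod l)%C. split.
    + rewrite Cmod_div, Cmod_conj, Cmod_R, Rabs_pos_eq; auto using Cmod_ge_0. now field.
    + replace (Cconj l / Cmod l * l)%C with (l * Cconj l / Cmod l)%C by (field; auto).
      rewrite <- Cmod2_conj, RtoC_pow. field; auto.
Qed.

Lemma Cmod_series_le_bound (u : nat -> C) (v : nat -> R) (l : C) (m : R) :
  is_Cseries u l -> (forall n, Cmod (u n) <= v n) ->
  (forall N, sum_n v N <= m) -> Cmod l <= m.
Proof.
  intros Hu Huv Hm.
  destruct (unimodular_rotation l) as [e [He Hel]].
  pose proof (is_series_Cmult_l e _ _ Hu) as H.
  rewrite Hel in H. apply is_Cseries_components in H. destruct H as [H _].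
  rewrite re_RtoC in H.
  refine (is_lim_seq_le _ _ (Cmod l) m _ H (is_lim_seq_const m)).
  intros N. eapply Rle_trans; [|apply (Hm N)]. apply sum_n_m_le. intros k.
  eapply Rle_trans; [apply Rle_abs|]. eapply Rle_trans; [apply re_le_Cmod|].
  rewrite Cmod_mult, He, Rmult_1_l. apply Huv.
Qed.

Lemma Cmod_series_le (u : nat -> C) (v : nat -> R) (l : C) (m : R) :
  is_Cseries u l -> is_series v m -> (forall n, Cmod (u n) <= v n) -> Cmod l <= m.
Proof.
  intros Hu Hv Huv. apply (Cmod_series_le_bound u v); auto.
  apply (is_lim_seq_incr_compare (sum_n v) m Hv). intros n. rewrite sum_Sn.
  specialize (Huv (S n)). pose proof (Cmod_ge_0 (u (S n))). unfold plus; simpl. lra.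
Qed.

(** The series is summed by components so that it is a total function of [u],
    like [Series]. *)
Definition CSeries (u : nat -> C) : C :=
  (Series (fun n => Re (u n)), Series (fun n => Im (u n))).

Lemma CSeries_unique (u : nat -> C) (l : C) : is_Cseries u l -> CSeries u = l.
Proof.
  intros H. apply is_Cseries_components in H. destruct H as [H1 H2].
  unfold CSeries. rewrite (is_series_unique _ _ H1), (is_series_unique _ _ H2).
  now destruct l.
Qed.

Lemma CSeries_correct (u : nat -> C) (v : nat -> R) :
  ex_series v -> (forall n, Cmod (u n) <= v n) -> is_Cseries u (CSeries u).
Proof.
  intros Hv Huv.
  destruct (ex_series_le (V := C_CompleteNormedModule) u v Huv Hv) as [l Hl].
  now rewrite (CSeries_unique u l Hl).
Qed.

(** * Power series on the unit disk *)

(** Absolute convergence of the power series with coefficients [c] on the open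
    unit disk. *)
Definition disk_coeffs (c : nat -> C) : Prop :=
  forall r, 0 <= r < 1 -> ex_series (fun n => Cmod (c n) * r ^ n).

Definition psum (c : nat -> C) (z : C) : C := CSeries (fun n => (c n * z ^ n)%C).

Lemma psum_correct (c : nat -> C) (z : C) : disk_coeffs c -> in_disk z ->
  is_Cseries (fun n => (c n * z ^ n)%C) (psum c z).
Proof.
  intros Hc Hz. apply (CSeries_correct _ (fun n => Cmod (c n) * Cmod z ^ n)).
  - apply Hc. split; [apply Cmod_ge_0|exact Hz].
  - intros n. rewrite Cmod_mult, Cmod_pow. lra.
Qed.

Lemma is_pseries_C (c : nat -> C) (z l : C) :
  is_Cpseries c z l <-> is_Cseries (fun n => (c n * z ^ n)%C) l.
Proof.
  unfold is_pseries. split; apply is_series_ext; intros n;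
  [exact (Cmult_comm (z ^ n) (c n)) | exact (Cmult_comm (c n) (z ^ n))].
Qed.

(** Absolute convergence reduces to the real power series of the moduli, so the
    results on [CV_radius] apply. *)
Lemma disk_coeffs_radius (c : nat -> C) :
  disk_coeffs c <-> Rbar_le 1 (CV_radius (fun n => Cmod (c n))).
Proof.
  split.
  - intros H. destruct (Rbar_le_lt_dec 1 (CV_radius (fun n => Cmod (c n)))) as [h|h]; auto.
    exfalso. pose proof (CV_radius_ge_0 (fun n => Cmod (c n))) as h0.
    destruct (CV_radius (fun n => Cmod (c n))) as [x| |] eqn:E; simpl in *; try easy.
    set (r := (x + 1) / 2).
    apply (CV_disk_outside (fun n => Cmod (c n)) r).
    + rewrite E. simpl. unfold r. rewrite Rabs_pos_eq; lra.
    + apply ex_series_lim_0, H. unfold r; lra.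
  - intros H r Hr.
    assert (Hx : Rbar_lt (Rabs r) (CV_radius (fun n => Cmod (c n)))).
    { eapply Rbar_lt_le_trans; [|exact H]. simpl. rewrite Rabs_pos_eq; lra. }
    apply CV_disk_inside in Hx. revert Hx. apply ex_series_ext. intros n.
    apply Rabs_pos_eq. apply Rmult_le_pos; [apply Cmod_ge_0|apply pow_le; lra].
Qed.

(** The Cauchy-Hadamard principle: outside the disk of absolute convergence the
    terms do not tend to zero. *)
Lemma pseries_disk_coeffs (c : nat -> C) :
  (forall z, in_disk z -> exists s, is_Cpseries c z s) ->
  disk_coeffs c.
Proof.
  intros H. apply disk_coeffs_radius.
  destruct (Rbar_le_lt_dec 1 (CV_radius (fun n => Cmod (c n)))) as [h|h]; auto.
  exfalso. pose proof (CV_radius_ge_0 (fun n => Cmod (c n))) as h0.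
  destruct (CV_radius (fun n => Cmod (c n))) as [x| |] eqn:E; simpl in *; try easy.
  set (r := (x + 1) / 2).
  apply (CV_disk_outside (fun n => Cmod (c n)) r).
  { rewrite E. simpl. unfold r. rewrite Rabs_pos_eq; lra. }
  assert (Hr : 0 <= r < 1) by (unfold r; lra).
  (* [r] lies strictly between the assumed radius and 1. *)
  destruct (H (RtoC r)) as [s Hs].
  { unfold in_disk. rewrite Cmod_R, Rabs_pos_eq; lra. }
  apply is_pseries_C, is_Cseries_components in Hs. destruct Hs as [H1 H2].
  assert (H1' := ex_series_lim_0 _ (ex_intro _ _ H1)).
  assert (H2' := ex_series_lim_0 _ (ex_intro _ _ H2)).
  apply is_lim_seq_abs in H1'. apply is_lim_seq_abs in H2'.
  simpl in H1', H2'. rewrite Rabs_R0 in H1', H2'.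
  assert (H3 := is_lim_seq_plus' _ _ _ _ H1' H2'). rewrite Rplus_0_l in H3.
  refine (is_lim_seq_le_le (fun _ => 0) _ _ 0 _ (is_lim_seq_const 0) H3).
  intros n. split. apply Rmult_le_pos; [apply Cmod_ge_0|apply pow_le; lra].
  replace (Cmod (c n) * r ^ n) with (Cmod (c n * r ^ n)).
  2: now rewrite Cmod_mult, Cmod_pow, Cmod_R, (Rabs_pos_eq r).
  apply Cmod_le_Re_Im.
Qed.

(** Coefficients of the derivative. *)
Definition dcoef (c : nat -> C) (n : nat) : C := (RtoC (INR (S n)) * c (S n))%C.

Lemma disk_coeffs_dcoef (c : nat -> C) : disk_coeffs (dcoef c) <-> disk_coeffs c.
Proof.
  rewrite !disk_coeffs_radius.
  rewrite <- (CV_radius_derive (fun n => Cmod (c n))).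
  rewrite (CV_radius_ext (PS_derive (fun n => Cmod (c n))) (fun n => Cmod (dcoef c n))).
  reflexivity.
  intros n. unfold PS_derive, dcoef. rewrite Cmod_mult, Cmod_R, Rabs_pos_eq; auto using pos_INR.
Qed.

Lemma disk_coeffs_plus (a b : nat -> C) : disk_coeffs a -> disk_coeffs b ->
  disk_coeffs (fun n => (a n + b n)%C).
Proof.
  intros Ha Hb r Hr.
  apply (ex_series_le (V := R_CompleteNormedModule) _
     (fun n => Cmod (a n) * r ^ n + Cmod (b n) * r ^ n)).
  - intros n. unfold norm; simpl. unfold abs; simpl.
    assert (0 <= r ^ n) by (apply pow_le; lra).
    rewrite Rabs_pos_eq by (apply Rmult_le_pos; auto using Cmod_ge_0).
    rewrite <- Rmult_plus_distr_r. apply Rmult_le_compat_r; auto. apply Cmod_triangle.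
  - apply (ex_series_plus (V := R_NormedModule)); auto.
Qed.

Lemma disk_coeffs_scal (k : C) (a : nat -> C) : disk_coeffs a ->
  disk_coeffs (fun n => (k * a n)%C).
Proof.
  intros Ha r Hr. apply (ex_series_ext (fun n => Cmod k * (Cmod (a n) * r ^ n))).
  intros n. rewrite Cmod_mult. now rewrite Rmult_assoc.
  apply (ex_series_scal_l (V := R_NormedModule)); auto.
Qed.

Lemma psum_plus (a b : nat -> C) z : disk_coeffs a -> disk_coeffs b -> in_disk z ->
  psum (fun n => (a n + b n)%C) z = (psum a z + psum b z)%C.
Proof.
  intros Ha Hb Hz. apply CSeries_unique.
  eapply is_series_ext; [|exact (is_series_plus (V := C_NormedModule) _ _ _ _
      (psum_correct a z Ha Hz) (psum_correct b z Hb Hz))].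
  intros n. change (a n * z ^ n + b n * z ^ n = (a n + b n) * z ^ n)%C. ring.
Qed.

Lemma psum_scal (k : C) (a : nat -> C) z : disk_coeffs a -> in_disk z ->
  psum (fun n => (k * a n)%C) z = (k * psum a z)%C.
Proof.
  intros Ha Hz. apply CSeries_unique.
  eapply is_series_ext; [|exact (is_series_Cmult_l k _ _ (psum_correct a z Ha Hz))].
  intros n. change (k * (a n * z ^ n) = (k * a n) * z ^ n)%C. ring.
Qed.

(** First-order Taylor remainder of [z^(n+2)]; the bound is the term of the
    second derived series at radius [r], which makes the remainders summable
    over [n]. *)
Lemma Cmod_pow_taylor (z w : C) (r : R) n : Cmod z <= r -> Cmod (z + w) <= r ->
  Cmod ((z + w) ^ S (S n) - z ^ S (S n) - RtoC (INR (S (S n))) * z ^ S n * w)%C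
  <= Cmod w ^ 2 * (INR (S (S n)) * INR (S n) * r ^ n).
Proof.
  intros Hz Hzw.
  assert (Hr : 0 <= r) by (pose proof (Cmod_ge_0 z); lra).
  induction n.
  - replace ((z + w) ^ 2 - z ^ 2 - INR 2 * z ^ 1 * w)%C with (w ^ 2)%C
      by (simpl; rewrite RtoC_plus; ring).
    rewrite Cmod_pow. simpl. nra.
  - replace ((z + w) ^ S (S (S n)) - z ^ S (S (S n)) - INR (S (S (S n))) * z ^ S (S n) * w)%C with
      ((z + w) * ((z + w) ^ S (S n) - z ^ S (S n) - INR (S (S n)) * z ^ S n * w)
        + w ^ 2 * (INR (S (S n)) * z ^ S n))%C.
    2: { rewrite (S_INR (S (S n))), RtoC_plus. simpl Cpow. ring. }
    eapply Rle_trans; [apply Cmod_triangle|].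
    rewrite !Cmod_mult, !Cmod_pow, Cmod_R, (Rabs_pos_eq (INR _)) by apply pos_INR.
    assert (H1 : Cmod (z + w) * Cmod ((z + w) ^ S (S n) - z ^ S (S n) - INR (S (S n)) * z ^ S n * w)
       <= r * (Cmod w ^ 2 * (INR (S (S n)) * INR (S n) * r ^ n))).
    { apply Rmult_le_compat; auto using Cmod_ge_0. }
    assert (H2 : Cmod w ^ 2 * (INR (S (S n)) * Cmod z ^ S n) <= Cmod w ^ 2 * (INR (S (S n)) * r ^ S n)).
    { apply Rmult_le_compat_l; [apply pow2_ge_0|]. apply Rmult_le_compat_l; [apply pos_INR|].
      apply pow_incr; split; auto using Cmod_ge_0. }
    eapply Rle_trans; [apply Rplus_le_compat; eassumption|].
    rewrite (S_INR (S (S n))), (S_INR (S n)). simpl pow.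
    assert (0 <= Cmod w * (Cmod w * 1) * ((INR (S n) + 1) * (r * r ^ n))).
    { repeat apply Rmult_le_pos; auto using Cmod_ge_0, pow_le; try lra.
      pose proof (pos_INR (S n)); lra. }
    lra.
Qed.

(** Summing [Cmod_pow_taylor] against the coefficients bounds the first-order
    remainder of the whole series by [M |w|^2], where [M] is the sum of the
    twice derived series of moduli at a radius between [|z|] and 1. *)
Lemma psum_derive (c : nat -> C) (z : C) : disk_coeffs c -> in_disk z ->
  is_derive_C (psum c) z (psum (dcoef c) z).
Proof.
  intros Hc Hz. apply is_derive_C_eps. intros eps Heps.
  set (r := (1 + Cmod z) / 2). unfold in_disk in Hz.
  pose proof (Cmod_ge_0 z) as Hz0.
  assert (Hr : 0 <= r < 1) by (unfold r; lra).
  assert (Hc1 : disk_coeffs (dcoef c)) by now apply disk_coeffs_dcoef.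
  assert (Hc2 : disk_coeffs (dcoef (dcoef c))) by now apply disk_coeffs_dcoef.
  destruct (Hc2 r Hr) as [M HM].
  assert (HM0 : 0 <= M).
  { apply (is_series_ge_0 _ _ HM). intros n.
    apply Rmult_le_pos; [apply Cmod_ge_0|apply pow_le; lra]. }
  exists (Rmin (r - Cmod z) (eps / (M + 1))). split.
  { apply Rmin_pos. unfold r; lra. apply Rdiv_lt_0_compat; lra. }
  intros w Hw.
  assert (Hw1 : Cmod w < r - Cmod z) by (eapply Rlt_le_trans; [exact Hw|apply Rmin_l]).
  assert (Hw2 : Cmod w < eps / (M + 1)) by (eapply Rlt_le_trans; [exact Hw|apply Rmin_r]).
  assert (Hzw : Cmod (z + w) <= r) by (eapply Rle_trans; [apply Cmod_triangle|lra]).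
  apply Rle_trans with (Cmod w ^ 2 * M).
  2: { apply (Rmult_lt_compat_r (M + 1)) in Hw2; [|lra].
       replace (eps / (M + 1) * (M + 1)) with eps in Hw2 by (field; lra).
       pose proof (Cmod_ge_0 w). simpl. nra. }
  pose proof (psum_correct c (z + w) Hc ltac:(unfold in_disk; lra)) as S1.
  pose proof (psum_correct c z Hc Hz) as S2.
  pose proof (is_series_Cmult_l w _ _ (psum_correct (dcoef c) z Hc1 Hz)) as S3.
  pose proof (is_series_minus (V := C_NormedModule) _ _ _ _ S1 S2) as S4.
  (* The derived series shifted by one, so that all three series are indexed by the power of [z]. *)
  set (D := fun n => match n with O => RtoC 0 | S k => (w * (dcoef c k * z ^ k))%C end).
  assert (S5 : is_Cseries D (w * psum (dcoef c) z)%C).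
  { apply is_series_decr_1.
    refine (eq_ind_r (fun l => is_Cseries _ l) S3 _).
    change (w * psum (dcoef c) z + - 0 = w * psum (dcoef c) z)%C. ring. }
  pose proof (is_series_minus (V := C_NormedModule) _ _ _ _ S4 S5) as S6.
  (* The remainder vanishes for the powers 0 and 1. *)
  set (v := fun n => match n with S (S k) => Cmod w ^ 2 * (Cmod (dcoef (dcoef c) k) * r ^ k) | _ => 0 end).
  assert (Sv : is_series v (Cmod w ^ 2 * M)).
  { apply is_series_decr_1, is_series_decr_1. simpl v.
    refine (eq_ind_r (fun l => is_series _ l) (is_series_scal_l (V := R_NormedModule) (Cmod w ^ 2) _ _ HM) _).
    change (Cmod w ^ 2 * M + - 0 + - 0 = Cmod w ^ 2 * M). ring. }
  replace (psum c (z + w) - psum c z - psum (dcoef c) z * w)%C with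
    (plus (plus (psum c (z + w)) (opp (psum c z))) (opp (w * psum (dcoef c) z)%C)).
  2: { change (psum c (z + w) + - psum c z + - (w * psum (dcoef c) z) =
         psum c (z + w) - psum c z - psum (dcoef c) z * w)%C. ring. }
  refine (Cmod_series_le _ v _ _ S6 Sv _). intros [|[|n]]; simpl v; unfold D, plus, opp; simpl.
  - match goal with |- Cmod ?e <= 0 => replace e with (RtoC 0) by ring end. rewrite Cmod_0; lra.
  - match goal with |- Cmod ?e <= 0 => replace e with (RtoC 0) end. rewrite Cmod_0; lra.
    unfold dcoef. simpl. ring.
  - eapply Rle_trans; [|apply Rle_trans with
       (Cmod (c (S (S n))) * (Cmod w ^ 2 * (INR (S (S n)) * INR (S n) * r ^ n)))].
    2: { apply Rmult_le_compat_l; [apply Cmod_ge_0|].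
         apply (Cmod_pow_taylor z w r n); [unfold r; lra|exact Hzw]. }
    + rewrite <- Cmod_mult. right. f_equal. unfold dcoef. simpl Cpow. ring.
    + right. unfold dcoef. rewrite !Cmod_mult, !Cmod_R, !Rabs_pos_eq by apply pos_INR.
      simpl pow. ring.
Qed.

(** * Analytic functions along real curves *)

Definition is_derive_curve (g : R -> C) (s : R) (v : C) : Prop :=
  is_derive (fun k => Re (g k)) s (Re v) /\ is_derive (fun k => Im (g k)) s (Im v).

Lemma is_derive_R_eps (f : R -> R) (x l : R) :
  is_derive f x l <-> forall eps, 0 < eps -> exists delta, 0 < delta /\
    forall k, Rabs k < delta -> Rabs (f (x + k) - f x - l * k) <= eps * Rabs k.
Proof.
  rewrite is_derive_Reals. split.
  - intros H eps Heps. destruct (H eps Heps) as [del Hd].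
    exists del; split; [apply cond_pos|]. intros k Hk.
    destruct (Req_dec k 0) as [->|Hk0].
    + replace (f (x + 0) - f x - l * 0) with 0 by (rewrite Rplus_0_r; ring).
      rewrite Rabs_R0; lra.
    + specialize (Hd k Hk0 Hk).
      replace (f (x + k) - f x - l * k) with (((f (x + k) - f x) / k - l) * k) by (field; auto).
      rewrite Rabs_mult. apply Rmult_le_compat_r; [apply Rabs_pos|lra].
  - intros H eps Heps. destruct (H (eps / 2) ltac:(lra)) as [del [Hdel Hd]].
    exists (mkposreal del Hdel). intros k Hk0 Hk. specialize (Hd k Hk).
    assert (0 < Rabs k) by (apply Rabs_pos_lt; auto).
    replace ((f (x + k) - f x) / k - l) with ((f (x + k) - f x - l * k) / k) by (field; auto).
    unfold Rdiv. rewrite Rabs_mult, Rabs_inv. apply (Rmult_lt_reg_r (Rabs k)); auto.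
    rewrite Rmult_assoc, Rinv_l, Rmult_1_r by lra. nra.
Qed.

Lemma is_derive_curve_eps (g : R -> C) (s : R) (v : C) :
  is_derive_curve g s v <-> forall eps, 0 < eps -> exists delta, 0 < delta /\
    forall k, Rabs k < delta -> Cmod (g (s + k)%R - g s - v * RtoC k)%C <= eps * Rabs k.
Proof.
  assert (HR : forall k, Re (g (s + k)%R - g s - v * k)%C = Re (g (s + k)) - Re (g s) - Re v * k).
  { intros k. unfold Re, Im; simpl. ring. }
  assert (HI : forall k, Im (g (s + k)%R - g s - v * k)%C = Im (g (s + k)) - Im (g s) - Im v * k).
  { intros k. unfold Re, Im; simpl. ring. }
  unfold is_derive_curve. rewrite !is_derive_R_eps. split.
  - intros [H1 H2] eps Heps.
    destruct (H1 (eps / 2) ltac:(lra)) as [d1 [Hd1 H1']].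
    destruct (H2 (eps / 2) ltac:(lra)) as [d2 [Hd2 H2']].
    exists (Rmin d1 d2). split; [now apply Rmin_pos|]. intros k Hk.
    specialize (H1' k ltac:(pose proof (Rmin_l d1 d2); lra)).
    specialize (H2' k ltac:(pose proof (Rmin_r d1 d2); lra)).
    rewrite <- HR in H1'. rewrite <- HI in H2'.
    set (w := (g (s + k)%R - g s - v * k)%C) in *.
    eapply Rle_trans; [apply Cmod_le_Re_Im|]. lra.
  - intros H. split; intros eps Heps; destruct (H eps Heps) as [d [Hd H']];
    exists d; split; auto; intros k Hk; specialize (H' k Hk).
    + rewrite <- HR. eapply Rle_trans; [apply re_le_Cmod|exact H'].
    + rewrite <- HI. eapply Rle_trans; [apply im_le_Cmod|exact H'].
Qed.

(** Chain rule for an analytic function along a real curve: all real partial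
    derivatives below come from it. *)
Lemma is_derive_curve_comp (f : C -> C) (g : R -> C) (s : R) (d v : C) :
  is_derive_C f (g s) d -> is_derive_curve g s v ->
  is_derive_curve (fun k => f (g k)) s (d * v)%C.
Proof.
  rewrite is_derive_C_eps, !is_derive_curve_eps. intros Hf Hg eps Heps.
  set (V := Cmod v + 1). pose proof (Cmod_ge_0 v) as Hv. pose proof (Cmod_ge_0 d) as Hd.
  assert (HV : 0 < V) by (unfold V; lra).
  destruct (Hf (eps / (2 * V))) as [d1 [Hd1 H1]].
  { apply Rdiv_lt_0_compat; lra. }
  destruct (Hg (Rmin 1 (eps / (2 * (Cmod d + 1))))) as [d2 [Hd2 H2]].
  { apply Rmin_pos; [lra|]. apply Rdiv_lt_0_compat; lra. }
  exists (Rmin d2 (d1 / V)). split. { apply Rmin_pos; auto. apply Rdiv_lt_0_compat; lra. }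
  intros k Hk.
  assert (Hk1 : Rabs k < d2) by (eapply Rlt_le_trans; [exact Hk|apply Rmin_l]).
  assert (Hk2 : Rabs k < d1 / V) by (eapply Rlt_le_trans; [exact Hk|apply Rmin_r]).
  specialize (H2 k Hk1). set (w := (g (s + k)%R - g s)%C) in *. pose proof (Rabs_pos k) as Hk0.
  assert (Hw : Cmod w <= V * Rabs k).
  { replace w with ((w - v * k) + v * k)%C by ring.
    eapply Rle_trans; [apply Cmod_triangle|]. rewrite Cmod_mult, Cmod_R.
    assert (Cmod (w - v * k) <= 1 * Rabs k).
    { eapply Rle_trans; [exact H2|]. apply Rmult_le_compat_r; auto. apply Rmin_l. }
    unfold V. lra. }
  assert (H1' : Cmod (f (g s + w) - f (g s) - d * w)%C <= eps / (2 * V) * Cmod w).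
  { apply H1. eapply Rle_lt_trans; [exact Hw|].
    apply (Rmult_lt_compat_l V) in Hk2; auto. replace (V * (d1 / V)) with d1 in Hk2 by (field; lra).
    exact Hk2. }
  replace (g s + w)%C with (g (s + k)%R) in H1' by (unfold w; ring).
  replace (f (g (s + k)%R) - f (g s) - d * v * k)%C with
    ((f (g (s + k)%R) - f (g s) - d * w) + d * (w - v * k))%C by ring.
  eapply Rle_trans; [apply Cmod_triangle|]. rewrite Cmod_mult.
  assert (eps / (2 * V) * Cmod w <= eps / 2 * Rabs k).
  { apply Rle_trans with (eps / (2 * V) * (V * Rabs k)).
    apply Rmult_le_compat_l; auto. apply Rlt_le, Rdiv_lt_0_compat; lra.
    right; field; lra. }
  assert (Cmod d * Cmod (w - v * k) <= eps / 2 * Rabs k).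
  { apply Rle_trans with ((Cmod d + 1) * (eps / (2 * (Cmod d + 1)) * Rabs k)).
    - apply Rmult_le_compat; auto using Cmod_ge_0; try lra.
      eapply Rle_trans; [exact H2|]. apply Rmult_le_compat_r; auto. apply Rmin_r.
    - right; field; lra. }
  lra.
Qed.

Lemma is_derive_curve_unique (g : R -> C) s v v' :
  is_derive_curve g s v -> is_derive_curve g s v' -> v = v'.
Proof.
  intros [H1 H2] [H1' H2'].
  apply is_derive_unique in H1. apply is_derive_unique in H2.
  apply is_derive_unique in H1'. apply is_derive_unique in H2'.
  destruct v, v'. unfold Re, Im in *; simpl in *. congruence.
Qed.

Lemma is_derive_curve_ext_loc (g g' : R -> C) s v :
  locally s (fun k => g k = g' k) -> is_derive_curve g s v -> is_derive_curve g' s v.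
Proof.
  intros He [H1 H2]. split; (eapply is_derive_ext_loc; [|eassumption]);
  revert He; apply filter_imp; intros k ->; reflexivity.
Qed.

Lemma is_derive_curve_line (z v : C) (t : R) :
  is_derive_curve (fun k => (z + RtoC k * v)%C) t v.
Proof.
  destruct z as [x y], v as [a b]. split; unfold Re, Im; simpl; auto_derive; auto; ring.
Qed.

Lemma is_derive_curve_conj (g : R -> C) s v :
  is_derive_curve g s v -> is_derive_curve (fun k => Cconj (g k)) s (Cconj v).
Proof.
  intros [H1 H2]. split. exact H1.
  exact (is_derive_opp (V := R_NormedModule) _ _ _ H2).
Qed.

(** * Uniqueness of the harmonic decomposition *)

Lemma in_disk_line (z v : C) : in_disk z ->
  locally 0 (fun k => in_disk (z + RtoC k * v)%C).
Proof.
  unfold in_disk. intros Hz. pose proof (Cmod_ge_0 v) as Hv.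
  assert (He : 0 < (1 - Cmod z) / (Cmod v + 1)) by (apply Rdiv_lt_0_compat; lra).
  exists (mkposreal _ He). intros k Hk.
  change (Rabs (k - 0) < (1 - Cmod z) / (Cmod v + 1)) in Hk. rewrite Rminus_0_r in Hk.
  eapply Rle_lt_trans; [apply Cmod_triangle|]. rewrite Cmod_mult, Cmod_R.
  apply (Rmult_lt_compat_r (Cmod v + 1)) in Hk; [|lra].
  replace ((1 - Cmod z) / (Cmod v + 1) * (Cmod v + 1)) with (1 - Cmod z) in Hk by (field; lra).
  pose proof (Rabs_pos k). nra.
Qed.

Lemma is_derive_C_minus (f g : C -> C) z d d' :
  is_derive_C f z d -> is_derive_C g z d' -> is_derive_C (fun w => (f w - g w)%C) z (d - d')%C.
Proof. exact (is_derive_minus (V := C_NormedModule) f g z d d'). Qed.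

(** The increment of [p] is complex linear in the direction and that of
    [conj q] is antilinear; the directions [1] and [Ci] force both to vanish. *)
Lemma analytic_antianalytic_derive_0 (p q : C -> C) z d d' : in_disk z ->
  (forall w, in_disk w -> p w = Cconj (q w)) ->
  is_derive_C p z d -> is_derive_C q z d' -> d = RtoC 0.
Proof.
  intros Hz Hpq Hp Hq.
  assert (H : forall v : C, (d * v)%C = Cconj (d' * v)).
  { intros v.
    apply (is_derive_curve_unique (fun k => p (z + RtoC k * v)%C) 0).
    - apply (is_derive_curve_comp p (fun k => (z + RtoC k * v)%C)).
      + replace (z + RtoC 0 * v)%C with z by ring. exact Hp.
      + apply is_derive_curve_line.
    - apply is_derive_curve_ext_loc with (fun k => Cconj (q (z + RtoC k * v)%C)).
      + generalize (in_disk_line z v Hz). apply filter_imp. intros k Hk. symmetry. now apply Hpq.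
      + apply is_derive_curve_conj. apply (is_derive_curve_comp q (fun k => (z + RtoC k * v)%C)).
        * replace (z + RtoC 0 * v)%C with z by ring. exact Hq.
        * apply is_derive_curve_line. }
  pose proof (H (RtoC 1)) as H1. pose proof (H Ci) as H2.
  destruct d as [a b], d' as [a' b']. unfold Cmult, Cconj, Ci, RtoC in *; simpl in *.
  injection H1. injection H2. intros. f_equal; lra.
Qed.

(** Integration along the segment from [0] to [z]. *)
Lemma zero_derive_constant (p : C -> C) :
  (forall z, in_disk z -> is_derive_C p z (RtoC 0)) -> forall z, in_disk z -> p z = p (RtoC 0).
Proof.
  intros Hp z Hz.
  assert (H : forall t, 0 <= t <= 1 -> is_derive_curve (fun k => p (0 + RtoC k * z)%C) t (RtoC 0)).
  { intros t Ht. pose proof (Cmult_0_l z) as E0.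
    apply (eq_ind _ (is_derive_curve _ t)) with (2 := E0).
    apply (is_derive_curve_comp p (fun k => (0 + RtoC k * z)%C)).
    - apply Hp. unfold in_disk in *. rewrite Cplus_0_l, Cmod_mult, Cmod_R, Rabs_pos_eq by lra.
      pose proof (Cmod_ge_0 z). nra.
    - apply is_derive_curve_line. }
  assert (E : p (0 + RtoC 0 * z)%C = p (0 + RtoC 1 * z)%C).
  { apply injective_projections.
    - exact (eq_is_derive (V := R_NormedModule) (fun k => Re (p (0 + RtoC k * z)%C)) 0 1
        (fun t Ht => proj1 (H t Ht)) Rlt_0_1).
    - exact (eq_is_derive (V := R_NormedModule) (fun k => Im (p (0 + RtoC k * z)%C)) 0 1
        (fun t Ht => proj2 (H t Ht)) Rlt_0_1). }
  replace (0 + RtoC 0 * z)%C with (RtoC 0) in E by ring.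
  replace (0 + RtoC 1 * z)%C with z in E by ring. auto.
Qed.

(** The two decompositions differ by [h - S = conj (T - g)], which is analytic
    and antianalytic, hence constant. *)
Lemma harmonic_decomposition_unique (h g S T : C -> C) :
  analytic_on_disk h -> analytic_on_disk g -> analytic_on_disk S -> analytic_on_disk T ->
  (forall z, in_disk z -> (h z + Cconj (g z) = S z + Cconj (T z))%C) ->
  h (RtoC 0) = S (RtoC 0) -> forall z, in_disk z -> h z = S z /\ g z = T z.
Proof.
  intros Hh Hg HS HT E E0.
  set (p := fun z => (h z - S z)%C). set (q := fun z => (T z - g z)%C).
  assert (Hpq : forall w, in_disk w -> p w = Cconj (q w)).
  { intros w Hw. unfold p, q. rewrite Cminus_conj. specialize (E w Hw).
    replace (h w) with (h w + Cconj (g w) - Cconj (g w))%C by ring. rewrite E. ring. }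
  assert (Hp : forall z, in_disk z -> is_derive_C p z (RtoC 0)).
  { intros z Hz.
    destruct (Hh z Hz) as [dh Dh], (Hg z Hz) as [dg Dg], (HS z Hz) as [dS DS], (HT z Hz) as [dT DT].
    pose proof (is_derive_C_minus _ _ _ _ _ Dh DS) as Dp.
    pose proof (is_derive_C_minus _ _ _ _ _ DT Dg) as Dq.
    rewrite <- (analytic_antianalytic_derive_0 p q z _ _ Hz Hpq Dp Dq). exact Dp. }
  assert (Hp0 : forall z, in_disk z -> p z = RtoC 0).
  { intros z Hz. rewrite (zero_derive_constant p Hp z Hz). unfold p. rewrite E0. ring. }
  intros z Hz. specialize (Hp0 z Hz).
  assert (Hq0 : q z = RtoC 0).
  { rewrite <- (Cconj_conj (q z)), <- Hpq, Hp0 by auto. unfold Cconj, RtoC; simpl. f_equal; ring. }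
  unfold p, q in *. split.
  - replace (h z) with (h z - S z + S z)%C by ring. rewrite Hp0. ring.
  - replace (T z) with (T z - g z + g z)%C by ring. rewrite Hq0. ring.
Qed.

Lemma locally_in_disk (z : C) : in_disk z ->
  @locally (AbsRing_UniformSpace C_AbsRing) z in_disk.
Proof.
  unfold in_disk. intros Hz. exists (mkposreal (1 - Cmod z) ltac:(lra)). intros y Hy.
  change (Cmod (y - z)%C < 1 - Cmod z) in Hy.
  replace y with (z + (y - z))%C by ring. eapply Rle_lt_trans; [apply Cmod_triangle|]. lra.
Qed.

(** The value of [C_derive] at a point is local, so agreement on the open disk
    is enough. *)
Lemma C_derive_psum (f : C -> C) (c : nat -> C) : disk_coeffs c ->
  (forall z, in_disk z -> f z = psum c z) ->
  forall z, in_disk z -> C_derive f z = psum (dcoef c) z.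
Proof.
  intros Hc Hf z Hz. apply is_C_derive_unique.
  apply (is_derive_ext_loc (V := C_NormedModule) (psum c)); [|now apply psum_derive].
  generalize (locally_in_disk z Hz). apply filter_imp. intros y Hy. symmetry; auto.
Qed.

Lemma psum_analytic (c : nat -> C) : disk_coeffs c -> analytic_on_disk (psum c).
Proof. intros Hc z Hz. eexists. now apply psum_derive. Qed.

(** * Logarithmic polar coordinates *)

(** Coefficients of the Euler derivative [z * d/dz], which is the derivative
    with respect to [log z]. *)
Definition ecoef (c : nat -> C) (n : nat) : C := (RtoC (INR n) * c n)%C.

Lemma disk_coeffs_ecoef (c : nat -> C) : disk_coeffs c -> disk_coeffs (ecoef c).
Proof.
  intros Hc. apply disk_coeffs_dcoef in Hc. revert Hc. rewrite !disk_coeffs_radius.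
  rewrite <- (CV_radius_incr_1 (fun n => Cmod (dcoef c n))).
  rewrite (CV_radius_ext (PS_incr_1 _) (fun n => Cmod (ecoef c n))); auto.
  intros [|n]; simpl; auto. unfold ecoef. simpl. rewrite Cmult_0_l, Cmod_0. reflexivity.
Qed.

Lemma psum_ecoef (c : nat -> C) z : disk_coeffs c -> in_disk z ->
  psum (ecoef c) z = (z * psum (dcoef c) z)%C.
Proof.
  intros Hc Hz. apply CSeries_unique. apply is_series_decr_1.
  assert (E : plus (z * psum (dcoef c) z)%C (opp (ecoef c 0 * z ^ 0)%C) = (z * psum (dcoef c) z)%C).
  { change (z * psum (dcoef c) z + - (RtoC 0 * c O * 1) = z * psum (dcoef c) z)%C. ring. }
  refine (eq_ind_r (fun l => is_Cseries _ l) _ E).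
  apply disk_coeffs_dcoef in Hc.
  eapply is_series_ext; [|exact (is_series_Cmult_l z _ _ (psum_correct (dcoef c) z Hc Hz))].
  intros n. change (z * (dcoef c n * z ^ n) = ecoef c (S n) * (z * z ^ n))%C.
  unfold ecoef, dcoef. ring.
Qed.

(** The point [exp (s + i t)]. *)
Definition polar (s t : R) : C := (exp s * cos t, exp s * sin t).

Lemma Cmod_polar s t : Cmod (polar s t) = exp s.
Proof.
  unfold Cmod, polar; simpl.
  replace (exp s * cos t * (exp s * cos t * 1) + exp s * sin t * (exp s * sin t * 1))
    with ((exp s)² * ((sin t)² + (cos t)²)) by (unfold Rsqr; ring).
  rewrite sin2_cos2, Rmult_1_r. apply sqrt_Rsqr. apply Rlt_le, exp_pos.
Qed.

Lemma polar_in_disk s t : s < 0 -> in_disk (polar s t).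
Proof. intros H. unfold in_disk. rewrite Cmod_polar, <- exp_0. now apply exp_increasing. Qed.

Lemma is_derive_polar_s s t : is_derive_curve (fun s => polar s t) s (polar s t).
Proof. split; unfold polar, Re, Im; simpl; auto_derive; auto; ring. Qed.

Lemma is_derive_polar_t s t : is_derive_curve (fun t => polar s t) t (Ci * polar s t)%C.
Proof. split; unfold polar, Re, Im, Ci; simpl; auto_derive; auto; ring. Qed.

(** With [log z = s + i t], the partial derivatives in [s] and [t] are the Euler
    derivative and [Ci] times it. *)
Lemma psum_polar_s (c : nat -> C) s t : disk_coeffs c -> s < 0 ->
  is_derive_curve (fun s => psum c (polar s t)) s (psum (ecoef c) (polar s t)).
Proof.
  intros Hc Hs. pose proof (polar_in_disk s t Hs) as Hd.
  rewrite psum_ecoef, Cmult_comm by auto.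
  apply (is_derive_curve_comp (psum c) (fun s => polar s t)).
  now apply psum_derive. apply is_derive_polar_s.
Qed.

Lemma psum_polar_t (c : nat -> C) s t : disk_coeffs c -> s < 0 ->
  is_derive_curve (fun t => psum c (polar s t)) t (Ci * psum (ecoef c) (polar s t))%C.
Proof.
  intros Hc Hs. pose proof (polar_in_disk s t Hs) as Hd.
  rewrite psum_ecoef by auto.
  replace (Ci * (polar s t * psum (dcoef c) (polar s t)))%C
    with (psum (dcoef c) (polar s t) * (Ci * polar s t))%C by ring.
  apply (is_derive_curve_comp (psum c) (fun t => polar s t)).
  now apply psum_derive. apply is_derive_polar_t.
Qed.

Definition continuous_2d_C (f : R -> R -> C) (s t : R) : Prop :=
  continuity_2d_pt (fun x y => Re (f x y)) s t /\ continuity_2d_pt (fun x y => Im (f x y)) s t.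

Lemma continuous_2d_C_comp (f : C -> C) (g : R -> R -> C) (s t : R) d :
  is_derive_C f (g s t) d -> continuous_2d_C g s t ->
  continuous_2d_C (fun x y => f (g x y)) s t.
Proof.
  rewrite is_derive_C_eps. intros Hf [G1 G2].
  destruct (Hf 1 Rlt_0_1) as [del [Hdel Hd]].
  assert (K : forall eps : posreal, locally_2d (fun x y => Cmod (f (g x y) - f (g s t))%C < eps) s t).
  { intros eps. pose proof (Cmod_ge_0 d) as Hd0.
    set (e := Rmin (del / 2) (eps / (2 * (Cmod d + 1)))).
    assert (He : 0 < e).
    { apply Rmin_pos; [lra|]. apply Rdiv_lt_0_compat; [apply cond_pos|lra]. }
    specialize (G1 (mkposreal e He)). specialize (G2 (mkposreal e He)). simpl in *.
    generalize (locally_2d_and _ _ _ _ G1 G2). apply locally_2d_impl, locally_2d_forall.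
    intros x y [H1 H2].
    set (w := (g x y - g s t)%C).
    assert (Hw : Cmod w < 2 * e).
    { eapply Rle_lt_trans; [apply Cmod_le_Re_Im|].
      change (Rabs (Re w) < e) in H1. change (Rabs (Im w) < e) in H2. lra. }
    assert (e <= del / 2) by apply Rmin_l.
    assert (e <= eps / (2 * (Cmod d + 1))) by apply Rmin_r.
    specialize (Hd w ltac:(lra)).
    replace (g s t + w)%C with (g x y) in Hd by (unfold w; ring).
    replace (f (g x y) - f (g s t))%C with ((f (g x y) - f (g s t) - d * w) + d * w)%C by ring.
    eapply Rle_lt_trans; [apply Cmod_triangle|]. rewrite Cmod_mult.
    apply Rle_lt_trans with ((Cmod d + 1) * Cmod w); [lra|].
    apply Rlt_le_trans with ((Cmod d + 1) * (2 * e)); [apply Rmult_lt_compat_l; lra|].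
    apply Rle_trans with ((Cmod d + 1) * (2 * (eps / (2 * (Cmod d + 1))))).
    apply Rmult_le_compat_l; lra. right; field; lra. }
  split; intros eps; generalize (K eps); apply locally_2d_impl, locally_2d_forall; intros x y H.
  - eapply Rle_lt_trans; [|exact H]. exact (re_le_Cmod (f (g x y) - f (g s t))%C).
  - eapply Rle_lt_trans; [|exact H]. exact (im_le_Cmod (f (g x y) - f (g s t))%C).
Qed.

Lemma continuous_2d_polar s t : continuous_2d_C polar s t.
Proof.
  split; unfold polar, Re, Im; simpl; apply continuity_2d_pt_mult.
  - apply (continuity_1d_2d_pt_comp exp (fun x _ => x)); [|apply continuity_2d_pt_id1].
    apply derivable_continuous_pt, derivable_pt_exp.
  - apply (continuity_1d_2d_pt_comp cos (fun _ y => y)); [|apply continuity_2d_pt_id2].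
    apply continuity_cos.
  - apply (continuity_1d_2d_pt_comp exp (fun x _ => x)); [|apply continuity_2d_pt_id1].
    apply derivable_continuous_pt, derivable_pt_exp.
  - apply (continuity_1d_2d_pt_comp sin (fun _ y => y)); [|apply continuity_2d_pt_id2].
    apply continuity_sin.
Qed.

Lemma continuous_2d_Cmod (f : R -> R -> C) s t : continuous_2d_C f s t ->
  continuity_2d_pt (fun x y => Cmod (f x y)) s t.
Proof.
  intros [H1 H2].
  apply (continuity_1d_2d_pt_comp sqrt (fun x y => Re (f x y) ^ 2 + Im (f x y) ^ 2)).
  - apply continuity_pt_sqrt. nra.
  - apply continuity_2d_pt_plus; simpl; repeat apply continuity_2d_pt_mult;
    auto using continuity_2d_pt_const.
Qed.

Lemma continuous_2d_psum_polar (c : nat -> C) s t : disk_coeffs c -> s < 0 ->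
  continuous_2d_C (fun x y => psum c (polar x y)) s t.
Proof.
  intros Hc Hs. eapply (continuous_2d_C_comp (psum c) polar).
  apply psum_derive; auto. now apply polar_in_disk. apply continuous_2d_polar.
Qed.

(** * Derivative and continuity of the modulus *)

(** The real part of [conj a * b]. *)
Definition Cdot (a b : C) : R := Re a * Re b + Im a * Im b.

Lemma Cdot_self a : Cdot a a = Cmod a ^ 2.
Proof. rewrite Cmod2_alt. unfold Cdot. ring. Qed.

Lemma is_derive_Cdot (g g' : R -> C) s v v' :
  is_derive_curve g s v -> is_derive_curve g' s v' ->
  is_derive (fun k => Cdot (g k) (g' k)) s (Cdot v (g' s) + Cdot (g s) v').
Proof.
  intros [H1 H2] [H1' H2']. unfold Cdot.
  evar_last.
  { apply (is_derive_plus (V := R_NormedModule));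
    (apply (is_derive_mult (K := R_AbsRing)); [eassumption|eassumption|exact Rmult_comm]). }
  unfold plus, mult; simpl. ring.
Qed.

Lemma is_derive_Cmod (g : R -> C) s v : is_derive_curve g s v -> g s <> 0 ->
  is_derive (fun k => Cmod (g k)) s (Cdot (g s) v / Cmod (g s)).
Proof.
  intros Hg Hs. assert (Hp : 0 < Cmod (g s)) by now apply Cmod_gt_0.
  apply (is_derive_ext (fun k => sqrt (Cdot (g k) (g k)))).
  { intros k. rewrite Cdot_self. apply sqrt_pow2, Cmod_ge_0. }
  evar_last. { apply is_derive_sqrt. apply is_derive_Cdot; exact Hg.
    rewrite Cdot_self. now apply pow_lt. }
  cbv beta. rewrite Cdot_self, sqrt_pow2 by apply Cmod_ge_0. unfold Cdot; field; lra.
Qed.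

Lemma is_derive_Cdot_over_Cmod (g g' : R -> C) s v v' :
  is_derive_curve g s v -> is_derive_curve g' s v' -> g s <> 0 ->
  is_derive (fun k => Cdot (g k) (g' k) / Cmod (g k)) s
   ((Cdot v (g' s) + Cdot (g s) v') / Cmod (g s) - Cdot (g s) (g' s) * Cdot (g s) v / Cmod (g s) ^ 3).
Proof.
  intros Hg Hg' Hs. assert (Hp : 0 < Cmod (g s)) by now apply Cmod_gt_0.
  evar_last. { apply is_derive_div. apply is_derive_Cdot; eassumption.
   apply is_derive_Cmod; eassumption. lra. }
  cbv beta. field; lra.
Qed.

(** * Integrals depending on a parameter *)

Lemma continuity_2d_pt_section (f : R -> R -> R) s t :
  continuity_2d_pt f s t -> continuous (f s) t.
Proof.
  intros H. apply filterlim_locally. intros eps.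
  destruct (H eps) as [d Hd]. exists d. intros y Hy. apply Hd; auto.
  rewrite Rminus_diag, Rabs_R0. apply cond_pos.
Qed.

Lemma locally_neg s : s < 0 -> locally s (fun x => x < 0).
Proof. intros H. exact (open_lt 0 s H). Qed.

Lemma ex_RInt_section (f : R -> R -> R) s a b :
  (forall t, continuity_2d_pt f s t) -> ex_RInt (f s) a b.
Proof.
  intros Hf. apply (ex_RInt_continuous (V := R_CompleteNormedModule)). intros t _.
  now apply continuity_2d_pt_section.
Qed.

(** Differentiation under the integral sign for integrands that are
    continuously differentiable in [x] on the half-plane [x < 0], the image of the punctured disk under [log]. *)
Lemma is_derive_RInt_neg (f df : R -> R -> R) a b s : s < 0 ->
  (forall x t, x < 0 -> is_derive (fun x => f x t) x (df x t)) ->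
  (forall x t, x < 0 -> continuity_2d_pt f x t) ->
  (forall x t, x < 0 -> continuity_2d_pt df x t) ->
  is_derive (fun x => RInt (f x) a b) s (RInt (df s) a b).
Proof.
  intros Hs Hd Hf Hdf.
  evar_last.
  - apply is_derive_RInt_param.
    + generalize (locally_neg s Hs). apply filter_imp. intros x Hx t _. eexists; now apply Hd.
    + intros t _. apply continuity_2d_pt_ext_loc with df; [|now apply Hdf].
      assert (H : locally_2d (fun x _ : R => x < 0) s t).
      { exists (mkposreal (- s) ltac:(lra)). simpl. intros x y Hx _.
        apply Rabs_def2 in Hx. lra. }
      revert H. apply locally_2d_impl, locally_2d_forall. intros x y Hx.
      symmetry. apply is_derive_unique. now apply Hd.
    + generalize (locally_neg s Hs). apply filter_imp. intros x Hx.
      apply (ex_RInt_section f). auto.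
  - apply RInt_ext. intros t _. apply is_derive_unique. now apply Hd.
Qed.

(** * A second-order comparison principle *)

Lemma power_solution (al x : R) : x < 0 ->
  is_derive (fun s => Rpower (- s) al) x (- al * Rpower (- x) (al - 1)).
Proof.
  intros Hx. unfold Rpower. auto_derive; [lra|].
  replace ((al - 1) * ln (- x)) with (al * ln (- x) - ln (- x)) by ring.
  unfold Rminus. rewrite exp_plus, exp_Ropp, exp_ln by lra. field; lra.
Qed.

Lemma nonincreasing_of_derive (f df : R -> R) (a b : R) : a <= b ->
  (forall x, a <= x <= b -> is_derive f x (df x)) ->
  (forall x, a <= x <= b -> df x <= 0) -> f b <= f a.
Proof.
  intros Hab Hd Hn.
  destruct (MVT_gen f a b df) as [c [Hc E]].
  - rewrite Rmin_left, Rmax_right by auto. intros x Hx. apply Hd; lra.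
  - rewrite Rmin_left, Rmax_right by auto. intros x Hx.
    apply derivable_continuous_pt. exists (df x). apply is_derive_Reals, Hd; lra.
  - rewrite Rmin_left, Rmax_right in Hc by auto. specialize (Hn c Hc).
    assert (0 <= - df c * (b - a)) by (apply Rmult_le_pos; lra). lra.
Qed.

(** The function [y s = (-s)^(-al)] solves [y'' = al (al + 1) / s^2 * y], so the
    Wronskian [U' y - U y'] is nonincreasing.  Hence [(U / y)' = W / y^2] is
    bounded above, as [1 <= y] on [[-1, 0)], and so is [U / y]. *)
Lemma ODE_comparison (U U1 U2 : R -> R) (al : R) : 0 < al ->
  (forall s, s < 0 -> is_derive U s (U1 s)) ->
  (forall s, s < 0 -> is_derive U1 s (U2 s)) ->
  (forall s, s < 0 -> U2 s <= al * (al + 1) / s ^ 2 * U s) ->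
  exists K, 0 < K /\ forall s, -1 <= s < 0 -> U s <= K * Rpower (- s) (- al).
Proof.
  intros Hal H1 H2 H.
  set (y := fun s => Rpower (- s) (- al)).
  set (y1 := fun s => al * Rpower (- s) (- al - 1)).
  set (y2 := fun s => al * (al + 1) * Rpower (- s) (- al - 1 - 1)).
  assert (Hy1 : forall s, s < 0 -> is_derive y s (y1 s)).
  { intros s Hs. evar_last. apply power_solution; auto. unfold y1. ring. }
  assert (Hy2 : forall s, s < 0 -> is_derive y1 s (y2 s)).
  { intros s Hs. evar_last. apply is_derive_scal. apply power_solution; auto. unfold y2.
    unfold scal; simpl; unfold mult; simpl. ring. }
  assert (Hyp : forall s, 0 < y s) by (intros; apply exp_pos).
  assert (Hyy : forall s, s < 0 -> y2 s = al * (al + 1) / s ^ 2 * y s).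
  { intros s Hs. unfold y2, y, Rpower.
    replace ((- al - 1 - 1) * ln (- s)) with (- al * ln (- s) + (- ln (- s) + - ln (- s))) by ring.
    rewrite !exp_plus, exp_Ropp, exp_ln by lra. field; lra. }
  set (W := fun s => U1 s * y s - U s * y1 s).
  assert (HW : forall s, -1 <= s < 0 -> W s <= W (-1)).
  { intros s Hs. apply (nonincreasing_of_derive W (fun s => U2 s * y s - U s * y2 s)); [lra| |].
    - intros x Hx. unfold W. evar_last.
      { apply (is_derive_minus (V := R_NormedModule));
        (apply (is_derive_mult (K := R_AbsRing)); [| |exact Rmult_comm]);
        [apply H2|apply Hy1|apply H1|apply Hy2]; lra. }
      unfold minus, plus, opp, mult; simpl. ring.
    - intros x Hx. rewrite Hyy by lra. specialize (H x ltac:(lra)). specialize (Hyp x). nra. }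
  set (M := Rabs (W (-1))).
  exists (Rabs (U (-1) / y (-1)) + M + 1). split.
  { pose proof (Rabs_pos (U (-1) / y (-1))). pose proof (Rabs_pos (W (-1))). unfold M. lra. }
  intros s Hs.
  assert (HV : U s / y s - M * s <= U (-1) / y (-1) - M * (-1)).
  { apply (nonincreasing_of_derive (fun s => U s / y s - M * s) (fun s => W s / y s ^ 2 - M)); [lra| |].
    - intros x Hx. evar_last.
      { apply (is_derive_minus (V := R_NormedModule)).
        - apply is_derive_div; [apply H1; lra|apply Hy1; lra|]. specialize (Hyp x); lra.
        - apply is_derive_scal, is_derive_id. }
      unfold minus, plus, opp, scal, mult, one; simpl. unfold mult, W; simpl.
      specialize (Hyp x). field. lra.
    - intros x Hx. assert (1 <= y x).
      { unfold y, Rpower. rewrite <- exp_0.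
        assert (ln (- x) <= 0). { rewrite <- ln_1. destruct (Req_dec x (-1)) as [->|].
          right; f_equal; ring. left; apply ln_increasing; lra. }
        destruct (Req_dec (- al * ln (- x)) 0) as [->|]; [lra|].
        left. apply exp_increasing. nra. }
      assert (W x <= M) by (eapply Rle_trans; [apply HW; lra|apply Rle_abs]).
      assert (0 <= M) by apply Rabs_pos.
      assert (W x / y x ^ 2 <= M); [|lra].
      apply (Rmult_le_reg_r (y x ^ 2)); [nra|].
      replace (W x / y x ^ 2 * y x ^ 2) with (W x) by (field; lra).
      assert (1 <= y x ^ 2) by nra. nra. }
  assert (0 <= M) by apply Rabs_pos.
  pose proof (Rle_abs (U (-1) / y (-1))).
  assert (U s / y s <= Rabs (U (-1) / y (-1)) + M + 1) by nra.
  replace (U s) with (U s / y s * y s) by (field; specialize (Hyp s); lra).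
  apply Rmult_le_compat_r; auto. left; apply Hyp.
Qed.

(** * Growth of the integral means *)

(** This is [sinh (- x) >= - x] multiplied by [2 exp x]. *)
Lemma two_mul_exp_le x : x < 0 -> 2 * (- x) * exp x <= 1 - exp x ^ 2.
Proof.
  intros Hx.
  assert (H : -2 * x <= exp (- x) - exp x).
  { assert (exp (- 0) - exp 0 + 2 * 0 <= exp (- x) - exp x + 2 * x); [|rewrite Ropp_0, exp_0 in *; lra].
    apply (nonincreasing_of_derive (fun x => exp (- x) - exp x + 2 * x)
       (fun x => - exp (- x) - exp x + 2)); [lra| |].
    - intros y _. auto_derive; auto. ring.
    - intros y _. rewrite exp_Ropp. pose proof (exp_pos y).
      assert (exp y * / exp y = 1) by (field; lra).
      assert (0 < / exp y) by (apply Rinv_0_lt_compat; auto).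
      pose proof (pow2_ge_0 (exp y - 1)).
      assert (0 <= (exp y - 1) ^ 2 * / exp y) by (apply Rmult_le_pos; lra).
      replace ((exp y - 1) ^ 2 * / exp y) with (exp y - 2 + / exp y) in H3 by (field; lra). lra. }
  pose proof (exp_pos x). rewrite exp_Ropp in H.
  apply (Rmult_le_compat_r (exp x)) in H; [|lra].
  replace ((/ exp x - exp x) * exp x) with (1 - exp x ^ 2) in H by (field; lra). lra.
Qed.

Definition mean (c : nat -> C) (s : R) : R :=
  RInt (fun t => Cmod (psum c (polar s t))) 0 (2 * PI).

Lemma alpha_pos lam : 0 < lam -> 0 < alpha lam.
Proof.
  intros H. unfold alpha. assert (1 < sqrt (1 + 4 * lam ^ 2)); [|lra].
  rewrite <- sqrt_1 at 1. apply sqrt_lt_1; nra.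
Qed.

(** The indicial equation of [y'' = lam^2 / s^2 * y]. *)
Lemma alpha_eq lam : alpha lam * (alpha lam + 1) = lam ^ 2.
Proof.
  unfold alpha. assert (E : sqrt (1 + 4 * lam ^ 2) ^ 2 = 1 + 4 * lam ^ 2) by (apply pow2_sqrt; nra).
  nra.
Qed.

Lemma continuous_Cdot (f g : R -> R -> C) s t : continuous_2d_C f s t -> continuous_2d_C g s t ->
  continuity_2d_pt (fun x y => Cdot (f x y) (g x y)) s t.
Proof.
  intros [H1 H2] [H3 H4]. unfold Cdot. apply continuity_2d_pt_plus; now apply continuity_2d_pt_mult.
Qed.

Section Mean.
Variables (c : nat -> C) (lam : R).
Hypotheses (Hlam : 0 < lam) (Hc : disk_coeffs c)
  (Hnz : forall z, in_disk z -> psum c z <> 0)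
  (Hb : forall z, in_disk z -> (1 - Cmod z ^ 2) * Cmod (psum (dcoef c) z) <= 2 * lam * Cmod (psum c z)).

(** [phi], [Ephi] and [EEphi] are a zero-free function and its first two Euler
    derivatives in the coordinates [s + i t = log z].  Then [radial] and
    [angular] are the partial derivative of [|phi|] in [s] and the opposite of
    the one in [t], and [radial_s], [angular_t] are their own derivatives in [s]
    and [t]. *)
Definition phi s t := psum c (polar s t).
Definition Ephi s t := psum (ecoef c) (polar s t).
Definition EEphi s t := psum (ecoef (ecoef c)) (polar s t).

Definition radial s t := Cdot (phi s t) (Ephi s t) / Cmod (phi s t).
Definition radial_s s t := (Cdot (Ephi s t) (Ephi s t) + Cdot (phi s t) (EEphi s t)) / Cmod (phi s t)
   - Cdot (phi s t) (Ephi s t) * Cdot (phi s t) (Ephi s t) / Cmod (phi s t) ^ 3.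
Definition angular s t := Cdot (phi s t) (- Ci * Ephi s t)%C / Cmod (phi s t).
Definition angular_t s t := (Cdot (Ci * Ephi s t)%C (- Ci * Ephi s t)%C + Cdot (phi s t) (EEphi s t)) / Cmod (phi s t)
   - Cdot (phi s t) (- Ci * Ephi s t)%C * Cdot (phi s t) (Ci * Ephi s t)%C / Cmod (phi s t) ^ 3.

Lemma Cmod_phi_pos s t : s < 0 -> 0 < Cmod (phi s t).
Proof. intros Hs. apply Cmod_gt_0, Hnz. now apply polar_in_disk. Qed.

(** The Laplacian of [|phi|]: the difference of [radial_s] and [angular_t] is
    [|Ephi|^2 / |phi|], because the squares of the real and imaginary parts of
    [conj phi * Ephi] add up to [|phi|^2 |Ephi|^2]. *)
Lemma radial_angular_identity s t : s < 0 -> radial_s s t = Cmod (Ephi s t) ^ 2 / Cmod (phi s t) + angular_t s t.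
Proof.
  intros Hs. pose proof (Cmod_phi_pos s t Hs) as Hp. unfold radial_s, angular_t.
  assert (E := Cmod2_alt (phi s t)). assert (E' := Cmod2_alt (Ephi s t)).
  set (u := Cmod (phi s t)) in *.
  unfold Cdot.
  destruct (phi s t) as [p1 p2], (Ephi s t) as [q1 q2], (EEphi s t) as [r1 r2].
  unfold Re, Im, Ci in *; simpl fst in *; simpl snd in *. rewrite E'.
  apply (Rmult_eq_reg_r (u ^ 3)); [|apply pow_nonzero; lra].
  field_simplify; try lra. rewrite E. ring.
Qed.

Lemma is_derive_Cmod_phi s t : s < 0 -> is_derive (fun s => Cmod (phi s t)) s (radial s t).
Proof.
  intros Hs. apply (is_derive_Cmod (fun s => phi s t)). now apply psum_polar_s. apply Hnz. now apply polar_in_disk.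
Qed.

Lemma is_derive_radial s t : s < 0 -> is_derive (fun s => radial s t) s (radial_s s t).
Proof.
  intros Hs. apply (is_derive_Cdot_over_Cmod (fun s => phi s t) (fun s => Ephi s t)).
  now apply psum_polar_s. apply psum_polar_s; auto using disk_coeffs_ecoef.
  apply Hnz. now apply polar_in_disk.
Qed.

Lemma is_derive_angular s t : s < 0 -> is_derive (fun t => angular s t) t (angular_t s t).
Proof.
  intros Hs. apply (is_derive_Cdot_over_Cmod (fun t => phi s t) (fun t => (- Ci * Ephi s t)%C)).
  - now apply psum_polar_t.
  - replace (EEphi s t) with (- Ci * (Ci * EEphi s t))%C
      by (unfold Ci, Cmult, Copp; destruct (EEphi s t); simpl; f_equal; ring).
    destruct (psum_polar_t (ecoef c) s t (disk_coeffs_ecoef c Hc) Hs) as [H1 H2].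
    fold (Ephi s t) in *. split.
    + apply (is_derive_ext (fun t => Im (Ephi s t))).
      { intros k. unfold Re, Im, Ci; simpl. unfold Ephi. ring. }
      evar_last; [exact H2|]. unfold Re, Im, Ci; simpl. unfold EEphi. ring.
    + apply (is_derive_ext (fun t => - Re (Ephi s t))).
      { intros k. unfold Re, Im, Ci; simpl. unfold Ephi. ring. }
      evar_last; [exact (is_derive_opp (V := R_NormedModule) _ _ _ H1)|].
      unfold Re, Im, Ci, opp; simpl. unfold EEphi. ring.
  - apply Hnz. now apply polar_in_disk.
Qed.

Lemma continuous_phi s t : s < 0 -> continuous_2d_C phi s t.
Proof. intros; now apply continuous_2d_psum_polar. Qed.
Lemma continuous_Ephi s t : s < 0 -> continuous_2d_C Ephi s t.
Proof. intros; apply continuous_2d_psum_polar; auto using disk_coeffs_ecoef. Qed.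
Lemma continuous_EEphi s t : s < 0 -> continuous_2d_C EEphi s t.
Proof. intros; apply continuous_2d_psum_polar; auto using disk_coeffs_ecoef. Qed.

Lemma continuous_Cmod_phi s t : s < 0 -> continuity_2d_pt (fun x y => Cmod (phi x y)) s t.
Proof.
  intros Hs. now apply continuous_2d_Cmod, continuous_phi.
Qed.

Lemma continuous_radial s t : s < 0 -> continuity_2d_pt radial s t.
Proof.
  intros Hs. unfold radial, Rdiv. apply continuity_2d_pt_mult.
  apply continuous_Cdot; auto using continuous_phi, continuous_Ephi.
  apply continuity_2d_pt_inv; auto using continuous_Cmod_phi. pose proof (Cmod_phi_pos s t Hs); lra.
Qed.

Lemma continuous_radial_s s t : s < 0 -> continuity_2d_pt radial_s s t.
Proof.
  intros Hs. unfold radial_s, Rdiv. apply continuity_2d_pt_minus; apply continuity_2d_pt_mult.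
  - apply continuity_2d_pt_plus; apply continuous_Cdot; auto using continuous_phi, continuous_Ephi, continuous_EEphi.
  - apply continuity_2d_pt_inv; auto using continuous_Cmod_phi. pose proof (Cmod_phi_pos s t Hs); lra.
  - apply continuity_2d_pt_mult; apply continuous_Cdot; auto using continuous_phi, continuous_Ephi, continuous_EEphi.
  - apply continuity_2d_pt_inv.
    + simpl. repeat apply continuity_2d_pt_mult; auto using continuous_Cmod_phi, continuity_2d_pt_const.
    + apply pow_nonzero. pose proof (Cmod_phi_pos s t Hs); lra.
Qed.

Lemma continuous_energy s t : s < 0 -> continuity_2d_pt (fun s t => Cmod (Ephi s t) ^ 2 / Cmod (phi s t)) s t.
Proof.
  intros Hs. unfold Rdiv. apply continuity_2d_pt_mult.
  - apply (continuity_2d_pt_ext (fun s t => Cdot (Ephi s t) (Ephi s t))). intros; apply Cdot_self.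
    apply continuous_Cdot; auto using continuous_Ephi.
  - apply continuity_2d_pt_inv; auto using continuous_Cmod_phi. pose proof (Cmod_phi_pos s t Hs); lra.
Qed.

Lemma continuous_angular_t s t : s < 0 -> continuous (angular_t s) t.
Proof.
  intros Hs. apply (continuous_ext (fun t => radial_s s t - Cmod (Ephi s t) ^ 2 / Cmod (phi s t))).
  intros y. rewrite radial_angular_identity by auto. apply Rplus_minus_l.
  apply (continuity_2d_pt_section (fun s t => radial_s s t - Cmod (Ephi s t) ^ 2 / Cmod (phi s t))).
  apply continuity_2d_pt_minus; auto using continuous_radial_s, continuous_energy.
Qed.

(** The integral of a derivative over a full period. *)
Lemma RInt_angular_t s : s < 0 -> is_RInt (angular_t s) 0 (2 * PI) 0.
Proof.
  intros Hs. evar_last.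
  { apply (is_RInt_derive (V := R_CompleteNormedModule) (angular s)).
    intros t _. now apply is_derive_angular. intros t _. now apply continuous_angular_t. }
  assert (E : polar s (2 * PI) = polar s 0) by (unfold polar; now rewrite cos_2PI, sin_2PI, cos_0, sin_0).
  unfold angular, phi, Ephi. rewrite E. apply (minus_eq_zero (G := R_AbelianGroup)).
Qed.

(** The angular part integrates to zero.  At [|z| = exp s] the hypothesis gives
    [|Ephi| <= lam / sinh (- s) * |phi| <= lam / (- s) * |phi|]. *)
Lemma RInt_radial_s_le s : s < 0 -> RInt (radial_s s) 0 (2 * PI) <= lam ^ 2 / s ^ 2 * mean c s.
Proof.
  intros Hs. pose proof PI_RGT_0.
  assert (E : RInt (radial_s s) 0 (2 * PI) = RInt (fun t => Cmod (Ephi s t) ^ 2 / Cmod (phi s t)) 0 (2 * PI)).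
  { rewrite (RInt_ext _ (fun t => plus (Cmod (Ephi s t) ^ 2 / Cmod (phi s t)) (angular_t s t))).
    2: { intros t _. now apply radial_angular_identity. }
    rewrite (RInt_plus (V := R_CompleteNormedModule)).
    - rewrite (is_RInt_unique _ _ _ _ (RInt_angular_t s Hs)). apply Rplus_0_r.
    - apply (ex_RInt_section (fun s t => Cmod (Ephi s t) ^ 2 / Cmod (phi s t))). intros; now apply continuous_energy.
    - eexists; now apply RInt_angular_t. }
  rewrite E. unfold mean. rewrite <- (RInt_scal (V := R_CompleteNormedModule)).
  2: { apply (ex_RInt_section (fun s t => Cmod (phi s t))). intros; now apply continuous_Cmod_phi. }
  apply RInt_le; [lra| | |].
  - apply (ex_RInt_section (fun s t => Cmod (Ephi s t) ^ 2 / Cmod (phi s t))). intros; now apply continuous_energy.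
  - apply (ex_RInt_scal (V := R_NormedModule)).
    apply (ex_RInt_section (fun s t => Cmod (phi s t))). intros; now apply continuous_Cmod_phi.
  - intros t _. change (Cmod (Ephi s t) ^ 2 / Cmod (phi s t) <= lam ^ 2 / s ^ 2 * Cmod (phi s t)).
    pose proof (Cmod_phi_pos s t Hs) as Hp. pose proof (polar_in_disk s t Hs) as Hd.
    specialize (Hb _ Hd). rewrite Cmod_polar in Hb. fold (phi s t) in Hb.
    assert (EQ : Cmod (Ephi s t) = exp s * Cmod (psum (dcoef c) (polar s t))).
    { unfold Ephi. rewrite psum_ecoef, Cmod_mult, Cmod_polar by auto. reflexivity. }
    assert (H1 : (- s) * Cmod (Ephi s t) <= lam * Cmod (phi s t)).
    { rewrite EQ. pose proof (two_mul_exp_le s Hs). pose proof (Cmod_ge_0 (psum (dcoef c) (polar s t))). nra. }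
    pose proof (Cmod_ge_0 (Ephi s t)).
    assert (H2 : ((- s) * Cmod (Ephi s t)) ^ 2 <= (lam * Cmod (phi s t)) ^ 2).
    { apply pow_incr. split; auto. apply Rmult_le_pos; lra. }
    apply (Rmult_le_reg_r (s ^ 2 * Cmod (phi s t))). { apply Rmult_lt_0_compat; nra. }
    replace (Cmod (Ephi s t) ^ 2 / Cmod (phi s t) * (s ^ 2 * Cmod (phi s t))) with (((- s) * Cmod (Ephi s t)) ^ 2) by (field; lra).
    replace (lam ^ 2 / s ^ 2 * Cmod (phi s t) * (s ^ 2 * Cmod (phi s t))) with ((lam * Cmod (phi s t)) ^ 2) by (field; lra).
    exact H2.
Qed.

(** [radial] and [radial_s] integrate to the first two derivatives of the mean,
    so [ODE_comparison] applies with [alpha lam * (alpha lam + 1) = lam ^ 2]. *)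
Lemma mean_growth : exists K, 0 < K /\ forall s, -1 <= s < 0 -> mean c s <= K * Rpower (- s) (- alpha lam).
Proof.
  apply (ODE_comparison (mean c) (fun s => RInt (radial s) 0 (2 * PI)) (fun s => RInt (radial_s s) 0 (2 * PI))).
  - now apply alpha_pos.
  - intros s Hs. apply (is_derive_RInt_neg (fun s t => Cmod (phi s t)) radial); auto using is_derive_Cmod_phi, continuous_Cmod_phi, continuous_radial.
  - intros s Hs. apply (is_derive_RInt_neg radial radial_s); auto using is_derive_radial, continuous_radial, continuous_radial_s.
  - intros s Hs. rewrite alpha_eq. now apply RInt_radial_s_le.
Qed.
End Mean.

(** * Coefficients and integral means *)

Lemma polar_mult s s' t t' : (polar s t * polar s' t')%C = polar (s + s') (t + t').
Proof.
  unfold polar, Cmult; simpl. rewrite exp_plus, cos_plus, sin_plus. f_equal; ring.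
Qed.

Lemma polar_pow s t k : (polar s t ^ k)%C = polar (INR k * s) (INR k * t).
Proof.
  induction k.
  - simpl. unfold polar. rewrite !Rmult_0_l, exp_0, cos_0, sin_0. unfold RtoC. f_equal; ring.
  - rewrite Cpow_S, IHk, polar_mult. f_equal; rewrite S_INR; ring.
Qed.

Lemma polar_period (k n : nat) s : polar s ((INR k - INR n) * (2 * PI)) = polar s 0.
Proof.
  replace ((INR k - INR n) * (2 * PI)) with ((0 + 2 * INR k * PI) - (0 + 2 * INR n * PI)) by ring.
  unfold polar. rewrite cos_minus, sin_minus, !cos_period, !sin_period, cos_0, sin_0.
  f_equal; ring.
Qed.

Lemma RInt_Re_polar_diag (d : C) s :
  is_RInt (fun t => Re (d * polar s 0)%C) 0 (2 * PI) (2 * PI * (exp s * Re d)).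
Proof.
  evar_last. apply (is_RInt_const (V := R_NormedModule)).
  unfold scal; simpl; unfold mult; simpl. unfold polar. rewrite cos_0, sin_0.
  unfold Re; simpl. ring.
Qed.

Lemma RInt_Re_polar_off (d : C) s (k n : nat) : k <> n ->
  is_RInt (fun t => Re (d * polar s ((INR k - INR n) * t))%C) 0 (2 * PI) 0.
Proof.
  intros Hkn. set (m := INR k - INR n).
  assert (Hm : m <> 0) by (unfold m; intros H; apply Hkn, INR_eq; lra).
  evar_last.
  - apply (is_RInt_derive (V := R_CompleteNormedModule) (fun t => Im (d * polar s (m * t))%C / m)).
    + intros t _. unfold polar, Re, Im; simpl. auto_derive; auto. field; auto.
    + intros t _. apply (ex_derive_continuous (V := R_NormedModule)).
      unfold polar, Re; simpl. auto_derive; auto.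
  - unfold m. rewrite polar_period, Rmult_0_r. apply (minus_eq_zero (G := R_AbelianGroup)).
Qed.

(** Orthogonality of the exponentials: multiplying by [polar 0 (- n t)] and
    integrating isolates the [n]-th coefficient. *)
Lemma RInt_partial_sum (c : nat -> C) (e : C) (n : nat) s M :
  is_RInt (fun t => Re (e * @sum_n C_NormedModule (fun k => (c k * polar s t ^ k)%C) M * polar 0 (- (INR n * t)))%C)
   0 (2 * PI) (if (n <=? M)%nat then 2 * PI * (exp (INR n * s) * Re (e * c n)%C) else 0).
Proof.
  assert (T : forall k t, (e * (c k * polar s t ^ k) * polar 0 (- (INR n * t)))%C
     = ((e * c k) * polar (INR k * s) ((INR k - INR n) * t))%C).
  { intros k t. rewrite polar_pow.
    replace ((INR k - INR n) * t) with (INR k * t + - (INR n * t)) by ring.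
    replace (INR k * s) with (INR k * s + 0) at 2 by ring.
    rewrite <- polar_mult. ring. }
  induction M.
  - apply is_RInt_ext with (fun t => Re ((e * c O) * polar (INR 0 * s) ((INR 0 - INR n) * t))%C).
    { intros t _. cbv beta. rewrite <- T, sum_O. reflexivity. }
    destruct n as [|n]; simpl Nat.leb; cbv iota.
    + apply is_RInt_ext with (fun t => Re ((e * c O) * polar (INR 0 * s) 0)%C).
      { intros t _. repeat f_equal. ring. }
      apply RInt_Re_polar_diag.
    + apply RInt_Re_polar_off. lia.
  - set (I := if (n =? S M)%nat then 2 * PI * (exp (INR n * s) * Re (e * c n)%C) else 0).
    assert (H : is_RInt (fun t => Re ((e * c (S M)) * polar (INR (S M) * s) ((INR (S M) - INR n) * t))%C) 0 (2 * PI) I).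
    { unfold I. destruct (Nat.eqb_spec n (S M)) as [->|Hn].
      - apply is_RInt_ext with (fun t => Re ((e * c (S M)) * polar (INR (S M) * s) 0)%C).
        { intros t _. repeat f_equal. ring. }
        apply RInt_Re_polar_diag.
      - apply RInt_Re_polar_off. lia. }
    evar_last.
    + eapply is_RInt_ext; [|exact (is_RInt_plus (V := R_NormedModule) _ _ _ _ _ _ IHM H)].
      intros t _. cbv beta. rewrite <- T, sum_Sn.
      change (Re (e * sum_n (fun k : nat => (c k * polar s t ^ k)%C : C_NormedModule) M * polar 0 (- (INR n * t)))%C
        + Re (e * (c (S M) * polar s t ^ S M) * polar 0 (- (INR n * t)))%C =
        Re (e * (sum_n (fun k : nat => (c k * polar s t ^ k)%C : C_NormedModule) M + (c (S M) * polar s t ^ S M)) * polar 0 (- (INR n * t)))%C).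
      rewrite <- re_plus. f_equal. ring.
    + unfold I. unfold plus; simpl.
      destruct (Nat.leb_spec n M), (Nat.eqb_spec n (S M)), (Nat.leb_spec n (S M)); try lia; try ring.
Qed.

(** Cauchy's estimate in the mean.  It is exact for partial sums; the tail of
    the series is uniformly small on the circle. *)
Lemma coefficient_le_mean (c : nat -> C) n s : disk_coeffs c -> s < 0 ->
  2 * PI * (exp (INR n * s) * Cmod (c n)) <= mean c s.
Proof.
  intros Hc Hs. pose proof PI_RGT_0 as HPI.
  set (r := exp s).
  assert (Hr : 0 <= r < 1).
  { unfold r. split; [left; apply exp_pos|]. rewrite <- exp_0. now apply exp_increasing. }
  destruct (Hc r Hr) as [T HT].
  destruct (unimodular_rotation (c n)) as [e [He1 He2]].
  replace (Cmod (c n)) with (Re (e * c n)%C) by (rewrite He2; apply re_RtoC).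
  apply le_epsilon. intros eps Heps.
  destruct (proj1 (filterlim_locally _ _) HT (mkposreal (eps / (2 * PI)) ltac:(apply Rdiv_lt_0_compat; lra))) as [N HN].
  set (M := max N n). specialize (HN M ltac:(unfold M; lia)).
  change (Rabs (sum_n (fun n => Cmod (c n) * r ^ n) M - T) < eps / (2 * PI)) in HN.
  pose proof (RInt_partial_sum c e n s M) as HI.
  replace (n <=? M)%nat with true in HI by (symmetry; apply Nat.leb_le; unfold M; lia).
  assert (HP : is_RInt (fun t => Cmod (psum c (polar s t)) + eps / (2 * PI)) 0 (2 * PI) (mean c s + eps)).
  { evar_last. apply (is_RInt_plus (V := R_NormedModule)).
    - apply (RInt_correct (V := R_CompleteNormedModule)).
      apply (ex_RInt_section (fun s t => Cmod (psum c (polar s t)))). intros t.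
      apply continuous_2d_Cmod. now apply continuous_2d_psum_polar.
    - apply (is_RInt_const (V := R_NormedModule)).
    - unfold mean, plus, scal; simpl; unfold mult; simpl. field. lra. }
  apply (is_RInt_le _ _ 0 (2 * PI) _ _ ltac:(lra) HI HP).
  intros t _.
  set (z := polar s t). set (SM := @sum_n C_NormedModule (fun k => (c k * z ^ k)%C) M).
  assert (Hz : in_disk z) by now apply polar_in_disk.
  assert (Htail : Cmod (psum c z - SM)%C <= T - sum_n (fun n => Cmod (c n) * r ^ n) M).
  { apply (Cmod_series_le (fun k => (c (S M + k)%nat * z ^ (S M + k))%C) (fun k => Cmod (c (S M + k)%nat) * r ^ (S M + k))).
    - apply (is_series_incr_n (V := C_NormedModule) (fun k => (c k * z ^ k)%C) (S M)); [lia|].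
      refine (eq_ind_r (fun l => is_Cseries _ l) (psum_correct c z Hc Hz) _).
      change (psum c z - SM + SM = psum c z)%C. ring.
    - apply (is_series_incr_n (V := R_NormedModule) (fun k => Cmod (c k) * r ^ k) (S M)); [lia|].
      refine (eq_ind_r (fun l => is_series _ l) HT _).
      set (X := sum_n (fun n => Cmod (c n) * r ^ n) M).
      change (T - X + X = T). ring.
    - intros k. rewrite Cmod_mult, Cmod_pow. unfold z. rewrite Cmod_polar. apply Rle_refl. }
  eapply Rle_trans; [apply Rle_abs|]. eapply Rle_trans; [apply re_le_Cmod|].
  rewrite !Cmod_mult, He1, Cmod_polar, exp_0, Rmult_1_l, Rmult_1_r.
  replace SM with (psum c z - (psum c z - SM))%C by ring.
  eapply Rle_trans; [apply Cmod_triangle|]. rewrite Cmod_opp.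
  apply Rabs_def2 in HN. lra.
Qed.

(** * The upper bound *)

Lemma psum_0 (c : nat -> C) : psum c (RtoC 0) = c O.
Proof.
  apply CSeries_unique, is_pseries_C. exact (is_pseries_0 (K := C_AbsRing) (V := C_NormedModule) c).
Qed.

(** A finite norm excludes zeros, so the quotient can be cleared of its
    denominator. *)
Lemma pS_norm_bound (h g : C -> C) lam : Rbar_le (pre_Schwarzian_norm h g) (Finite (2 * lam)) ->
  forall theta z, in_disk z -> pS_den h g theta z <> 0 /\
   (0 <= theta <= 2 * PI ->
    (1 - Cmod z ^ 2) * Cmod (pS_num h g theta z) <= 2 * lam * Cmod (pS_den h g theta z)).
Proof.
  unfold pre_Schwarzian_norm. destruct (excluded_middle_informative _) as [H|H]; [easy|].
  intros HL theta z Hz.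
  assert (Hd : pS_den h g theta z <> 0) by (intros E; apply H; eauto).
  split; auto. intros Hth.
  match type of HL with Rbar_le (Lub_Rbar ?E) _ => destruct (Lub_Rbar_correct E) as [Hub _] end.
  assert (HB := Rbar_le_trans _ _ _ (Hub _ (ex_intro _ z (ex_intro _ theta (conj Hz (conj Hth eq_refl))))) HL).
  simpl in HB. rewrite Cmod_div in HB by auto.
  assert (Hp : 0 < Cmod (pS_den h g theta z)) by now apply Cmod_gt_0.
  apply (Rmult_le_compat_r (Cmod (pS_den h g theta z))) in HB; [|lra].
  eapply Rle_trans; [|exact HB]. right. simpl. field. lra.
Qed.

Lemma Rpower_inv x y : 0 < x -> Rpower (/ x) (- y) = Rpower x y.
Proof. intros Hx. unfold Rpower. rewrite ln_Rinv by auto. f_equal; ring. Qed.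

(** Cauchy's estimate on the circle of radius [exp (- 1 / n)], where [exp (n s)]
    is the constant [exp (- 1)]. *)
Lemma coefficient_growth (c : nat -> C) (lam : R) : 0 < lam -> disk_coeffs c ->
  (forall z, in_disk z -> psum (dcoef c) z <> 0) ->
  (forall z, in_disk z ->
    (1 - Cmod z ^ 2) * Cmod (psum (dcoef (dcoef c)) z) <= 2 * lam * Cmod (psum (dcoef c) z)) ->
  exists K, forall n, (2 <= n)%nat -> Cmod (c n) <= K * Rpower (INR n) (alpha lam - 1).
Proof.
  intros Hlam Hc Hnz Hb.
  assert (Hc1 : disk_coeffs (dcoef c)) by now apply disk_coeffs_dcoef.
  destruct (mean_growth (dcoef c) lam Hlam Hc1 Hnz Hb) as [K [HK0 HK]].
  pose proof PI_RGT_0 as HPI. pose proof (alpha_pos lam Hlam) as Hal.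
  exists (K * exp 1 / (2 * PI)).
  intros [|[|n]] Hn; try lia. clear Hn.
  assert (Hn0 : 0 < INR (S n)) by (apply lt_0_INR; lia).
  assert (Hn1 : 1 <= INR (S n)) by (rewrite S_INR; pose proof (pos_INR n); lra).
  assert (Hi : 0 < / INR (S n)) by (apply Rinv_0_lt_compat; auto).
  assert (Hi1 : / INR (S n) <= 1) by (rewrite <- Rinv_1; apply Rinv_le_contravar; lra).
  set (s := - / INR (S n)).
  assert (Hs : -1 <= s < 0) by (unfold s; lra).
  pose proof (coefficient_le_mean (dcoef c) (S n) s Hc1 ltac:(lra)) as H1.
  specialize (HK s Hs). replace (- s) with (/ INR (S n)) in HK by (unfold s; ring).
  rewrite Rpower_inv in HK by auto.
  replace (INR (S n) * s) with (Ropp 1) in H1 by (unfold s; field; lra).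
  rewrite exp_Ropp in H1. unfold dcoef in H1 at 1.
  rewrite Cmod_mult, Cmod_R, Rabs_pos_eq in H1 by apply pos_INR.
  set (N := INR (S (S n))) in *.
  assert (HN : 0 < N) by (apply lt_0_INR; lia).
  assert (H2 : Rpower (INR (S n)) (alpha lam) <= Rpower N (alpha lam)).
  { apply Rle_Rpower_l; [lra|]. split; auto. unfold N. apply le_INR; lia. }
  assert (H3 : Rpower N (alpha lam - 1) = Rpower N (alpha lam) / N).
  { unfold Rminus. rewrite Rpower_plus, Rpower_Ropp, Rpower_1 by auto. reflexivity. }
  rewrite H3. pose proof (exp_pos 1) as He.
  assert (H4 : 2 * PI * (/ exp 1 * (N * Cmod (c (S (S n))))) <= K * Rpower N (alpha lam)).
  { eapply Rle_trans; [exact H1|]. eapply Rle_trans; [exact HK|]. apply Rmult_le_compat_l; lra. }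
  apply (Rmult_le_compat_l (exp 1 / (2 * PI * N))) in H4.
  2: { left. apply Rdiv_lt_0_compat; auto. apply Rmult_lt_0_compat; lra. }
  replace (exp 1 / (2 * PI * N) * (2 * PI * (/ exp 1 * (N * Cmod (c (S (S n)))))))
    with (Cmod (c (S (S n)))) in H4 by (field; repeat split; lra).
  eapply Rle_trans; [exact H4|]. right. field. split; lra.
Qed.

(** The analytic functions [h + expi theta * g] have coefficients
    [a n + expi theta * b n]; the angles [0] and [PI] give [a n + b n] and
    [a n - b n]. *)
Lemma gamma_upper_bound lam f x : 0 < lam -> B_H lam f -> is_gamma f x ->
  Rbar_le x (Finite (alpha lam)).
Proof.
  intros Hlam [h [g [[Hh [Hg [Hf [Hh0 [Hg0 _]]]]] Hnorm]]] [a [b [[Ha0 [Hb0 [_ [_ Hexp]]]] ->]]].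
  assert (Da : disk_coeffs a).
  { apply pseries_disk_coeffs. intros z Hz. destruct (Hexp z Hz) as [s [t [H _]]]. eauto. }
  assert (Db : disk_coeffs b).
  { apply pseries_disk_coeffs. intros z Hz. destruct (Hexp z Hz) as [s [t [_ [H _]]]]. eauto. }
  assert (Hhg : forall z, in_disk z -> h z = psum a z /\ g z = psum b z).
  { apply harmonic_decomposition_unique; auto using psum_analytic.
    - intros z Hz. rewrite <- Hf by auto. destruct (Hexp z Hz) as [s [t [H1 [H2 ->]]]].
      apply is_pseries_C in H1. apply is_pseries_C in H2.
      apply CSeries_unique in H1. apply CSeries_unique in H2. unfold psum. now rewrite H1, H2.
    - now rewrite psum_0, Hh0, Ha0. }
  assert (H1 : forall z, in_disk z -> C_derive h z = psum (dcoef a) z)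
    by (apply C_derive_psum; auto; intros; now apply Hhg).
  assert (H2 : forall z, in_disk z -> C_derive g z = psum (dcoef b) z)
    by (apply C_derive_psum; auto; intros; now apply Hhg).
  assert (Da1 : disk_coeffs (dcoef a)) by now apply disk_coeffs_dcoef.
  assert (Db1 : disk_coeffs (dcoef b)) by now apply disk_coeffs_dcoef.
  assert (H3 := C_derive_psum _ _ Da1 H1). assert (H4 := C_derive_psum _ _ Db1 H2).
  assert (HK : forall theta, 0 <= theta <= 2 * PI -> exists K, forall n, (2 <= n)%nat ->
    Cmod (a n + expi theta * b n)%C <= K * Rpower (INR n) (alpha lam - 1)).
  { intros th Hth.
    set (c := fun n => (a n + expi th * b n)%C).
    assert (Dc : disk_coeffs c) by (apply disk_coeffs_plus; auto; now apply disk_coeffs_scal).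
    assert (E1 : forall n, dcoef c n = (dcoef a n + expi th * dcoef b n)%C)
      by (intros n; unfold dcoef, c; ring).
    assert (E2 : forall n, dcoef (dcoef c) n = (dcoef (dcoef a) n + expi th * dcoef (dcoef b) n)%C)
      by (intros n; unfold dcoef, c; ring).
    assert (Da2 : disk_coeffs (dcoef (dcoef a))) by now apply disk_coeffs_dcoef.
    assert (Db2 : disk_coeffs (dcoef (dcoef b))) by now apply disk_coeffs_dcoef.
    assert (P1 : forall z, in_disk z -> psum (dcoef c) z = pS_den h g th z).
    { intros z Hz. unfold pS_den. rewrite H1, H2 by auto.
      rewrite <- psum_scal, <- psum_plus by auto using disk_coeffs_scal.
      unfold psum, CSeries. f_equal; apply Series_ext; intros n; now rewrite E1. }
    assert (P2 : forall z, in_disk z -> psum (dcoef (dcoef c)) z = pS_num h g th z).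
    { intros z Hz. unfold pS_num. rewrite H3, H4 by auto.
      rewrite <- psum_scal, <- psum_plus by auto using disk_coeffs_scal.
      unfold psum, CSeries. f_equal; apply Series_ext; intros n; now rewrite E2. }
    apply (coefficient_growth c lam); auto.
    - intros z Hz. rewrite P1 by auto. now apply (pS_norm_bound h g lam).
    - intros z Hz. rewrite P1, P2 by auto. now apply (pS_norm_bound h g lam). }
  pose proof PI_RGT_0.
  destruct (HK 0 ltac:(lra)) as [K1 HK1]. destruct (HK PI ltac:(lra)) as [K2 HK2].
  apply (proj1 (Glb_Rbar_correct _)).
  exists (K1 + K2). exists 2%nat. intros n Hn.
  specialize (HK1 n Hn). specialize (HK2 n Hn).
  replace (expi 0) with (RtoC 1) in HK1 by (unfold expi; now rewrite cos_0, sin_0).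
  replace (expi PI) with (RtoC (-1)) in HK2 by (unfold expi; now rewrite cos_PI, sin_PI).
  set (p := (a n + 1 * b n)%C) in *. set (q := (a n + -1 * b n)%C) in *.
  assert (Ea : (RtoC 2 * a n = p + q)%C) by (unfold p, q; ring).
  assert (Eb : (RtoC 2 * b n = p + - q)%C) by (unfold p, q; ring).
  apply (f_equal Cmod) in Ea. apply (f_equal Cmod) in Eb.
  rewrite Cmod_mult, Cmod_R, Rabs_pos_eq in Ea, Eb by lra.
  pose proof (Cmod_triangle p q). pose proof (Cmod_triangle p (- q)). rewrite Cmod_opp in *. lra.
Qed.

(** * Analytic members of the class *)

Lemma Cdot_le a b : Rabs (Cdot a b) <= Cmod a * Cmod b.
Proof.
  replace (Cdot a b) with (Re (Cconj a * b)%C).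
  - rewrite <- (Cmod_conj a), <- Cmod_mult. apply re_le_Cmod.
  - destruct a, b. unfold Cdot, Re, Im; simpl. ring.
Qed.

(** Gronwall's inequality on the segment from [0] to [z]: with
    [k = lam / (1 - |z|)], the function [exp (2 k t) * |psum c (t z)|^2] is
    nondecreasing, hence at least [|c 0|^2 > 0]. *)
Lemma psum_nonvanishing (c : nat -> C) lam : 0 < lam -> disk_coeffs c -> c O <> 0 ->
  (forall z, in_disk z -> (1 - Cmod z) * Cmod (psum (dcoef c) z) <= lam * Cmod (psum c z)) ->
  forall z, in_disk z -> psum c z <> 0.
Proof.
  intros Hlam Hc H0 Hb z Hz. unfold in_disk in Hz. pose proof (Cmod_ge_0 z) as Hz0.
  set (k := lam / (1 - Cmod z)).
  assert (Hk : 0 < k) by (apply Rdiv_lt_0_compat; lra).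
  set (p := fun t : R => psum c (0 + RtoC t * z)%C).
  set (dp := fun t : R => (psum (dcoef c) (0 + RtoC t * z) * z)%C).
  assert (Hin : forall t : R, 0 <= t <= 1 -> Cmod (0 + RtoC t * z) <= Cmod z).
  { intros t Ht. rewrite Cplus_0_l, Cmod_mult, Cmod_R, Rabs_pos_eq by lra. nra. }
  assert (Hd : forall t, 0 <= t <= 1 -> is_derive_curve p t (dp t)).
  { intros t Ht. apply (is_derive_curve_comp (psum c) (fun k => (0 + RtoC k * z)%C)).
    - apply psum_derive; auto. specialize (Hin t Ht). unfold in_disk. lra.
    - apply is_derive_curve_line. }
  assert (HG : - (exp (2 * k * 1) * Cdot (p 1) (p 1)) <= - (exp (2 * k * 0) * Cdot (p 0) (p 0))).
  { apply (nonincreasing_of_derive (fun t => - (exp (2 * k * t) * Cdot (p t) (p t)))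
      (fun t => - (exp (2 * k * t) * (2 * (k * Cdot (p t) (p t) + Cdot (p t) (dp t)))))); [lra| |].
    - intros t Ht. evar_last.
      { apply (is_derive_opp (V := R_NormedModule)), (is_derive_mult (K := R_AbsRing)).
        - apply (is_derive_comp exp (fun t => 2 * k * t)); [apply is_derive_exp|].
          apply is_derive_scal, is_derive_id.
        - apply is_derive_Cdot; now apply Hd.
        - exact Rmult_comm. }
      unfold opp, plus, mult, scal, one; simpl. unfold mult; simpl.
      unfold Cdot. ring.
    - intros t Ht. specialize (Hin t Ht).
      assert (H1 := Hb (0 + RtoC t * z)%C ltac:(unfold in_disk; lra)). fold (p t) in H1.
      assert (H2 : Cmod (dp t) <= k * Cmod (p t)).
      { unfold dp. rewrite Cmod_mult. set (D := Cmod (psum (dcoef c) (0 + t * z))) in *.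
        assert (HD : 0 <= D) by apply Cmod_ge_0.
        assert (H3 : (1 - Cmod z) * D <= lam * Cmod (p t)).
        { eapply Rle_trans; [|exact H1]. apply Rmult_le_compat_r; lra. }
        apply (Rmult_le_compat_l (/ (1 - Cmod z))) in H3.
        2: { left; apply Rinv_0_lt_compat; lra. }
        replace (/ (1 - Cmod z) * ((1 - Cmod z) * D)) with D in H3 by (field; lra).
        replace (/ (1 - Cmod z) * (lam * Cmod (p t))) with (k * Cmod (p t)) in H3 by (unfold k; field; lra).
        nra. }
      assert (H3 : Rabs (Cdot (p t) (dp t)) <= k * Cdot (p t) (p t)).
      { rewrite Cdot_self. eapply Rle_trans; [apply Cdot_le|]. pose proof (Cmod_ge_0 (p t)). nra. }
      apply Rabs_le_between in H3. pose proof (exp_pos (2 * k * t)).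
      assert (0 <= exp (2 * k * t) * (2 * (k * Cdot (p t) (p t) + Cdot (p t) (dp t)))); [|lra].
      apply Rmult_le_pos; lra. }
  intros E.
  assert (E1 : p 1 = 0) by (unfold p; replace (0 + 1 * z)%C with z by ring; exact E).
  assert (E0 : p 0 = c O) by (unfold p; replace (0 + 0 * z)%C with (RtoC 0) by ring; apply psum_0).
  rewrite E1, E0, !Cdot_self, Cmod_0, Rmult_0_r, exp_0 in HG.
  apply Cmod_gt_0 in H0. nra.
Qed.

(** Coefficients of the antiderivative that vanishes at [0]. *)
Definition icoef (c : nat -> C) (n : nat) : C :=
  match n with O => RtoC 0 | S k => (c k / RtoC (INR (S k)))%C end.

Lemma dcoef_icoef c n : dcoef (icoef c) n = c n.
Proof.
  unfold dcoef, icoef. field. intros E. apply RtoC_inj in E. revert E. apply not_0_INR. lia.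
Qed.

Lemma disk_coeffs_ext (a b : nat -> C) : (forall n, a n = b n) -> disk_coeffs a -> disk_coeffs b.
Proof.
  intros E H r Hr. eapply ex_series_ext; [|exact (H r Hr)]. intros n. simpl. now rewrite E.
Qed.

Lemma psum_ext (a b : nat -> C) z : (forall n, a n = b n) -> psum a z = psum b z.
Proof. intros E. unfold psum, CSeries. f_equal; apply Series_ext; intros n; now rewrite E. Qed.

Lemma C_derive_0 (f : C -> C) : (forall z, f z = RtoC 0) -> forall z, C_derive f z = RtoC 0.
Proof.
  intros Hf z. apply is_C_derive_unique.
  apply (is_derive_ext (V := C_NormedModule) (fun _ => RtoC 0)). intros; now rewrite Hf.
  exact (is_derive_const (V := C_NormedModule) (RtoC 0) z).
Qed.

(** The membership criterion for the examples: [c] lists the coefficients of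
    [h'], and [1 - |z|^2 <= 2 (1 - |z|)]. *)
Lemma analytic_example (c : nat -> C) lam : 0 < lam -> disk_coeffs c -> c O = RtoC 1 ->
  (forall z, in_disk z -> (1 - Cmod z) * Cmod (psum (dcoef c) z) <= lam * Cmod (psum c z)) ->
  B_H lam (psum (icoef c)) /\
  is_gamma (psum (icoef c)) (growth_exponent (icoef c) (fun _ => RtoC 0)).
Proof.
  intros Hlam Hc H0 Hb.
  assert (Hnz : forall z, in_disk z -> psum c z <> 0).
  { apply (psum_nonvanishing c lam); auto. rewrite H0. exact C1_nz. }
  assert (Hi : disk_coeffs (icoef c)).
  { apply disk_coeffs_dcoef. revert Hc. apply disk_coeffs_ext. intros n. now rewrite dcoef_icoef. }
  assert (D1 : forall z, in_disk z -> C_derive (psum (icoef c)) z = psum c z).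
  { intros z Hz. rewrite (C_derive_psum _ (icoef c)) by auto. apply psum_ext, dcoef_icoef. }
  assert (D2 := C_derive_psum _ _ Hc D1).
  set (g := fun _ : C => RtoC 0).
  assert (G1 : forall z, C_derive g z = RtoC 0) by now apply C_derive_0.
  assert (G2 : forall z, C_derive (C_derive g) z = RtoC 0) by now apply C_derive_0.
  assert (Ic : in_disk (RtoC 0)).
  { unfold in_disk. rewrite Cmod_0. lra. }
  assert (Ec0 : Cconj (RtoC 0) = RtoC 0) by (unfold Cconj, RtoC; simpl; f_equal; ring).
  split.
  - exists (psum (icoef c)), g. split.
    + repeat split.
      * now apply psum_analytic.
      * intros z _. exists (RtoC 0). exact (is_derive_const (V := C_NormedModule) (RtoC 0) z).
      * intros z _. unfold g. rewrite Ec0. ring.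
      * now rewrite psum_0.
      * rewrite D1, psum_0 by auto. exact H0.
    + assert (Hden : forall theta z, in_disk z -> pS_den (psum (icoef c)) g theta z = psum c z).
      { intros th z Hz. unfold pS_den. rewrite D1, G1 by auto. ring. }
      assert (Hnum : forall theta z, in_disk z -> pS_num (psum (icoef c)) g theta z = psum (dcoef c) z).
      { intros th z Hz. unfold pS_num. rewrite D2, G2 by auto. ring. }
      unfold pre_Schwarzian_norm. destruct (excluded_middle_informative _) as [[th [z [Hz E]]]|_].
      * exfalso. rewrite Hden in E by auto. now apply (Hnz z).
      * apply (proj2 (Lub_Rbar_correct _)). intros x [z [th [Hz [_ ->]]]]. simpl.
        rewrite Hden, Hnum, Cmod_div by auto.
        assert (Hp : 0 < Cmod (psum c z)) by now apply Cmod_gt_0, Hnz.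
        specialize (Hb z Hz). unfold in_disk in Hz. pose proof (Cmod_ge_0 z).
        apply (Rmult_le_reg_r (Cmod (psum c z))); auto.
        replace ((1 - Cmod z * (Cmod z * 1)) * (Cmod (psum (dcoef c) z) / Cmod (psum c z)) * Cmod (psum c z))
          with ((1 + Cmod z) * ((1 - Cmod z) * Cmod (psum (dcoef c) z))) by (field; lra).
        apply Rle_trans with ((1 + Cmod z) * (lam * Cmod (psum c z))).
        { apply Rmult_le_compat_l; lra. }
        assert (0 <= lam * Cmod (psum c z)) by (apply Rmult_le_pos; lra). nra.
  - exists (icoef c), (fun _ => RtoC 0). split; auto. repeat split.
    + simpl. rewrite H0. field.
    + intros z Hz. exists (psum (icoef c) z), (RtoC 0). repeat split.
      * apply is_pseries_C. now apply psum_correct.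
      * apply is_pseries_C.
        pose proof (is_series_Cmult_l 0 _ _ (psum_correct (icoef c) z Hi Hz)) as Hs.
        rewrite Cmult_0_l in Hs. revert Hs. apply is_series_ext. intros n.
        change (0 * (icoef c n * z ^ n) = 0 * z ^ n)%C. ring.
      * rewrite Ec0. ring.
Qed.

(** * Lower bounds for the growth exponent *)

Lemma eventually_lt_Rpower (K d : R) : 0 < d -> eventually (fun n => K < Rpower (INR n) d).
Proof.
  intros Hd. set (K1 := Rmax K 1). assert (1 <= K1) by apply Rmax_r. assert (K <= K1) by apply Rmax_l.
  destruct (nfloor_ex (Rpower (K1 + 1) (/ d)) ltac:(left; apply exp_pos)) as [N [_ HN]].
  exists (S N). intros n Hn. apply le_INR in Hn. rewrite S_INR in Hn.
  assert (Hp : 0 < Rpower (K1 + 1) (/ d)) by apply exp_pos.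
  apply Rlt_le_trans with (K1 + 1); [lra|].
  apply Rle_trans with (Rpower (Rpower (K1 + 1) (/ d)) d).
  { rewrite Rpower_mult, Rinv_l, Rpower_1 by lra. apply Rle_refl. }
  apply Rle_Rpower_l; lra.
Qed.

Lemma growth_exponent_ge (a b : nat -> C) (g0 : R) :
  (forall g K, g < g0 -> ~ eventually (fun n => Cmod (a n) + Cmod (b n) <= K * Rpower (INR n) (g - 1))) ->
  Rbar_le (Finite g0) (growth_exponent a b).
Proof.
  intros H. apply (proj2 (Glb_Rbar_correct _)). intros g [K HK]. simpl.
  destruct (Rle_lt_dec g0 g) as [h|h]; auto. exfalso. exact (H g K h HK).
Qed.

(** * The binomial series *)

(** Taylor coefficients of [(1 - z)^(- lam)]. *)
Fixpoint binom_coef (lam : R) (n : nat) : R :=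
  match n with O => 1 | S k => binom_coef lam k * ((lam + INR k) / INR (S k)) end.

Lemma binom_coef_S lam n :
  binom_coef lam (S n) = binom_coef lam n * ((lam + INR n) / INR (S n)).
Proof. reflexivity. Qed.

Lemma binom_coef_pos lam n : 0 < lam -> 0 < binom_coef lam n.
Proof.
  intros Hl. induction n; [exact Rlt_0_1|]. rewrite binom_coef_S. apply Rmult_lt_0_compat; auto.
  apply Rdiv_lt_0_compat. pose proof (pos_INR n); lra. apply lt_0_INR; lia.
Qed.

Lemma disk_coeffs_binom lam : 0 < lam -> disk_coeffs (fun n => RtoC (binom_coef lam n)).
Proof.
  intros Hl. apply disk_coeffs_radius.
  rewrite (CV_radius_finite_DAlembert _ 1); [rewrite Rinv_1; apply Rbar_le_refl| |lra|].
  - intros n. pose proof (binom_coef_pos lam n Hl). rewrite Cmod_R, Rabs_pos_eq; lra.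
  - apply (is_lim_seq_ext (fun n => 1 + (lam - 1) * / INR (S n))).
    + intros n. pose proof (binom_coef_pos lam n Hl). pose proof (binom_coef_pos lam (S n) Hl).
      assert (0 < INR (S n)) by (apply lt_0_INR; lia).
      rewrite !Cmod_R, !(Rabs_pos_eq (binom_coef _ _)) by lra.
      rewrite Rabs_pos_eq by (left; apply Rdiv_lt_0_compat; auto).
      rewrite binom_coef_S. rewrite S_INR in *. field. lra.
    + replace (Finite 1) with (Rbar_plus 1 (Rbar_mult (lam - 1) 0)) by (simpl; f_equal; ring).
      apply is_lim_seq_plus'; [apply is_lim_seq_const|].
      apply (is_lim_seq_scal_l _ (lam - 1) 0).
      apply (is_lim_seq_incr_1 (fun n => / INR n)).
      apply (is_lim_seq_inv INR p_infty is_lim_seq_INR). easy.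
Qed.

(** The recursion of the coefficients says [(1 - z) phi' = lam * phi], which
    replaces the closed form [(1 - z)^(- lam)]. *)
Lemma binom_ODE lam z : 0 < lam -> in_disk z ->
  let c := fun n => RtoC (binom_coef lam n) in
  ((1 - z) * psum (dcoef c) z)%C = (lam * psum c z)%C.
Proof.
  intros Hl Hz c. assert (Hc := disk_coeffs_binom lam Hl). fold c in Hc.
  assert (Hd : disk_coeffs (dcoef c)) by now apply disk_coeffs_dcoef.
  replace ((1 - z) * psum (dcoef c) z)%C with (psum (dcoef c) z + (-1) * (z * psum (dcoef c) z))%C by ring.
  rewrite <- psum_ecoef by auto.
  rewrite <- !psum_scal, <- psum_plus by auto using disk_coeffs_scal, disk_coeffs_ecoef.
  apply psum_ext. intros n. unfold dcoef, ecoef, c. rewrite <- !RtoC_mult, <- RtoC_plus. f_equal.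
  rewrite binom_coef_S. assert (0 < INR (S n)) by (apply lt_0_INR; lia). field. lra.
Qed.

Lemma ln_le_sub1 x : 0 < x -> ln x <= x - 1.
Proof. intros Hx. pose proof (exp_ineq1_le (ln x)). rewrite exp_ln in H by auto. lra. Qed.

Lemma exp_nondecreasing x y : x <= y -> exp x <= exp y.
Proof. intros [H| ->]; [left; now apply exp_increasing|lra]. Qed.

(** With [x = n + lam], [mu = lam - 1] the ratio of consecutive left sides is
    [((x + 1) / x)^mu] and that of right sides is [x / (x - mu)].  Their
    logarithms are separated by [mu / x], by [ln y <= y - 1] applied to
    [(x + 1) / x] and to [(x - mu) / x]. *)
Lemma binom_coef_lower lam n : 1 < lam ->
  Rpower (INR n + lam) (lam - 1) <= Rpower lam (lam - 1) * binom_coef lam n.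
Proof.
  intros Hl. set (mu := lam - 1). induction n.
  - simpl. rewrite Rplus_0_l, Rmult_1_r. lra.
  - rewrite binom_coef_S. pose proof (pos_INR n) as Hn. rewrite S_INR.
    assert (H : Rpower ((INR n + 1 + lam) / (INR n + lam)) mu <= (lam + INR n) / (INR n + 1)).
    { assert (H1 : ln ((INR n + 1 + lam) / (INR n + lam)) <= (INR n + 1 + lam) / (INR n + lam) - 1)
        by (apply ln_le_sub1, Rdiv_lt_0_compat; lra).
      assert (H2 : ln ((INR n + 1) / (lam + INR n)) <= (INR n + 1) / (lam + INR n) - 1)
        by (apply ln_le_sub1, Rdiv_lt_0_compat; lra).
      assert (H3 : ln ((lam + INR n) / (INR n + 1)) = - ln ((INR n + 1) / (lam + INR n))).
      { rewrite <- ln_Rinv by (apply Rdiv_lt_0_compat; lra). f_equal. field; lra. }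
      rewrite <- (exp_ln ((lam + INR n) / (INR n + 1))) by (apply Rdiv_lt_0_compat; lra).
      unfold Rpower. apply exp_nondecreasing. rewrite H3.
      apply (Rmult_le_compat_l mu) in H1; [|unfold mu; lra].
      replace (mu * ((INR n + 1 + lam) / (INR n + lam) - 1)) with (mu / (INR n + lam)) in H1 by (field; lra).
      replace ((INR n + 1) / (lam + INR n) - 1) with (- (mu / (INR n + lam))) in H2 by (unfold mu; field; lra).
      lra. }
    replace (INR n + 1 + lam) with ((INR n + lam) * ((INR n + 1 + lam) / (INR n + lam))) by (field; lra).
    rewrite <- Rpower_mult_distr by (try apply Rdiv_lt_0_compat; lra).
    rewrite <- Rmult_assoc. apply Rmult_le_compat; auto; left; apply exp_pos.
Qed.

(** The function with [h' = (1 - z)^(- lam)] satisfies the membership criterion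
    because [1 - |z| <= |1 - z|]. *)
Lemma gamma_lower_large lam : 1 < lam -> exists f x, B_H lam f /\ is_gamma f x /\ Rbar_le (Finite (lam - 1)) x.
Proof.
  intros Hl. set (c := fun n => RtoC (binom_coef lam n)).
  assert (Hc : disk_coeffs c) by (apply disk_coeffs_binom; lra).
  destruct (analytic_example c lam) as [H1 H2]; auto; try lra.
  { intros z Hz. pose proof (binom_ODE lam z ltac:(lra) Hz) as H. cbv zeta in H. fold c in H.
    apply (f_equal Cmod) in H. rewrite !Cmod_mult, Cmod_R, (Rabs_pos_eq lam) in H by lra. rewrite <- H.
    apply Rmult_le_compat_r; [apply Cmod_ge_0|].
    pose proof (Cmod_triangle (1 - z) z) as T. replace (1 - z + z)%C with (RtoC 1) in T by ring.
    rewrite Cmod_1 in T. lra. }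
  do 2 eexists. split; [exact H1|]. split; [exact H2|].
  apply growth_exponent_ge. intros g K Hg [N HN].
  set (D := Rpower lam (lam - 1)). assert (HD : 0 < D) by apply exp_pos.
  destruct (eventually_lt_Rpower (K * D) (lam - 1 - g) ltac:(lra)) as [N' HN'].
  set (m := max N N'). specialize (HN (S m) ltac:(unfold m; lia)). specialize (HN' (S m) ltac:(unfold m; lia)).
  rewrite Cmod_0, Rplus_0_r in HN. unfold icoef, c in HN.
  assert (Hm : 0 < INR (S m)) by (apply lt_0_INR; lia).
  pose proof (binom_coef_pos lam m ltac:(lra)) as Hb.
  rewrite <- RtoC_div, Cmod_R, Rabs_pos_eq in HN.
  2: { left. now apply Rdiv_lt_0_compat. }
  2: lra.
  pose proof (binom_coef_lower lam m Hl) as HL. fold D in HL.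
  assert (HP : Rpower (INR (S m)) (lam - 1) <= Rpower (INR m + lam) (lam - 1)).
  { apply Rle_Rpower_l; [lra|]. rewrite S_INR in *. lra. }
  set (x := INR (S m)) in *.
  assert (E1 : Rpower x (lam - 1) = Rpower x (lam - 1 - g) * (x * Rpower x (g - 1))).
  { replace (x * Rpower x (g - 1)) with (Rpower x 1 * Rpower x (g - 1)) by now rewrite Rpower_1.
    rewrite <- !Rpower_plus. f_equal. ring. }
  assert (H3 : Rpower x (g - 1) * (K * D) < Rpower x (g - 1) * Rpower x (lam - 1 - g))
    by (apply Rmult_lt_compat_l; auto; apply exp_pos).
  apply (Rmult_le_compat_r (x * D)) in HN; [|left; now apply Rmult_lt_0_compat].
  replace (binom_coef lam m / x * (x * D)) with (D * binom_coef lam m) in HN by (field; lra).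
  rewrite E1 in HP. nra.
Qed.

(** * A lacunary series *)

(** Differences of this slowly decreasing sequence are the coefficients of the
    second example: their sum telescopes, and the sequence drops only at powers
    of two. *)
Definition log_decay (n : nat) : R := / (1 + INR (Nat.log2 n)).

Lemma log_decay_bounds n : 0 < log_decay n <= 1.
Proof.
  unfold log_decay. pose proof (pos_INR (Nat.log2 n)). split.
  - apply Rinv_0_lt_compat; lra.
  - rewrite <- Rinv_1. apply Rinv_le_contravar; lra.
Qed.

Lemma log_decay_decr n : log_decay (S n) <= log_decay n.
Proof.
  unfold log_decay. pose proof (pos_INR (Nat.log2 n)). apply Rinv_le_contravar; [lra|].
  apply Rplus_le_compat_l, le_INR, Nat.log2_le_mono. lia.
Qed.

Definition log_jump (n : nat) : R := log_decay n - log_decay (S n).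

Lemma log_jump_bounds n : 0 <= log_jump n <= 1.
Proof.
  unfold log_jump. pose proof (log_decay_decr n).
  pose proof (log_decay_bounds n). pose proof (log_decay_bounds (S n)). lra.
Qed.

Lemma log_jump_sum N : sum_n log_jump N <= 1.
Proof.
  assert (E : sum_n log_jump N = 1 - log_decay (S N)).
  { induction N.
    - rewrite sum_O. unfold log_jump, log_decay. simpl. field.
    - rewrite sum_Sn, IHN. unfold log_jump, plus; simpl. ring. }
  pose proof (log_decay_bounds (S N)). lra.
Qed.

(** [Nat.log2] passes from [m - 1] to [m] at [2 ^ m]. *)
Lemma log_jump_pow2 m : (1 <= m)%nat -> log_jump (2 ^ m - 1) = / (INR m * (INR m + 1)).
Proof.
  intros Hm. unfold log_jump, log_decay.
  assert (2 ^ m <> 0)%nat by (apply Nat.pow_nonzero; lia).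
  replace (S (2 ^ m - 1)) with (2 ^ m)%nat by lia.
  rewrite Nat.log2_pow2 by lia.
  replace (2 ^ m - 1)%nat with (Nat.pred (2 ^ m)) by lia.
  rewrite Nat.log2_pred_pow2 by lia.
  assert (1 <= INR m) by (apply (le_INR 1); auto).
  replace (INR (Nat.pred m)) with (INR m - 1).
  - field. lra.
  - destruct m; [lia|]. simpl Nat.pred. rewrite S_INR. ring.
Qed.

Definition dyadic_coef (eps : R) (n : nat) : C :=
  match n with O => RtoC 1 | S k => RtoC (eps * log_jump k) end.

(** [(n + 1) r^n] is at most the sum of [r^0, ..., r^n], and [1 - r] times that
    sum is [1 - r^(n+1)]. *)
Lemma pow_weight r n : 0 <= r < 1 -> (1 - r) * (INR (S n) * r ^ n) <= 1.
Proof.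
  intros Hr. assert (H : (1 - r) * (INR (S n) * r ^ n) <= 1 - r ^ S n).
  { induction n.
    - simpl. lra.
    - rewrite S_INR. assert (0 <= r ^ S n) by (apply pow_le; lra).
      assert (r ^ S n <= 1) by (rewrite <- (pow1 (S n)); apply pow_incr; lra).
      replace ((1 - r) * ((INR (S n) + 1) * r ^ S n)) with
        (r * ((1 - r) * (INR (S n) * r ^ n)) + (1 - r) * r ^ S n) by (simpl; ring).
      replace (r ^ S (S n)) with (r * r ^ S n) by reflexivity. nra. }
  assert (0 <= r ^ S n) by (apply pow_le; lra). lra.
Qed.

Lemma dyadic_coef_le_1 eps : 0 < eps < 1 -> forall n, Cmod (dyadic_coef eps n) <= 1.
Proof.
  intros He [|n]; simpl.
  - rewrite Cmod_1. lra.
  - pose proof (log_jump_bounds n). rewrite Cmod_R, Rabs_pos_eq by nra. nra.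
Qed.

Lemma disk_coeffs_dyadic eps : 0 < eps < 1 -> disk_coeffs (dyadic_coef eps).
Proof.
  intros He. set (c := dyadic_coef eps).
  assert (Hcle := dyadic_coef_le_1 eps He). fold c in Hcle.
  intros r Hr. apply (ex_series_le (V := R_CompleteNormedModule) _ (fun n => r ^ n)).
  - intros n. unfold norm; simpl. unfold abs; simpl.
    assert (0 <= r ^ n) by (apply pow_le; lra). specialize (Hcle n). pose proof (Cmod_ge_0 (c n)).
    rewrite Rabs_pos_eq by now apply Rmult_le_pos. nra.
  - exists (/ (1 - r)). apply is_series_geom. rewrite Rabs_pos_eq; lra.
Qed.

(** The jumps add up to at most 1, so [|phi - 1| <= eps] and
    [(1 - |z|) |phi'| <= eps]. *)
Lemma dyadic_pre_Schwarzian eps z : 0 < eps < 1 -> in_disk z ->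
  (1 - Cmod z) * Cmod (psum (dcoef (dyadic_coef eps)) z) <=
  eps / (1 - eps) * Cmod (psum (dyadic_coef eps) z).
Proof.
  intros He Hz. set (c := dyadic_coef eps).
  assert (Hc := disk_coeffs_dyadic eps He). fold c in Hc.
  assert (Hsum : forall N, sum_n (fun k => eps * log_jump k) N <= eps).
  { intros N. pose proof (log_jump_sum N).
    apply Rle_trans with (eps * sum_n log_jump N); [|nra].
    right. exact (sum_n_mult_l (K := R_Ring) eps log_jump N). }
  pose proof (Cmod_ge_0 z) as Hz0. unfold in_disk in Hz.
  assert (L1 : (1 - Cmod z) * Cmod (psum (dcoef c) z) <= eps).
  { rewrite <- (Rabs_pos_eq (1 - Cmod z)) by lra. rewrite <- Cmod_R, <- Cmod_mult.
    apply (Cmod_series_le_bound _ (fun k => eps * log_jump k) _ _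
      (is_series_Cmult_l _ _ _ (psum_correct (dcoef c) z (proj2 (disk_coeffs_dcoef c) Hc) Hz))); auto.
    intros n. cbv beta. unfold dcoef. rewrite !Cmod_mult, Cmod_pow, !Cmod_R, !Rabs_pos_eq by (auto using pos_INR; lra).
    simpl c. rewrite Cmod_R. pose proof (log_jump_bounds n). rewrite Rabs_pos_eq by nra.
    pose proof (pow_weight (Cmod z) n (conj Hz0 Hz)).
    replace ((1 - Cmod z) * (INR (S n) * (eps * log_jump n) * Cmod z ^ n)) with
      ((eps * log_jump n) * ((1 - Cmod z) * (INR (S n) * Cmod z ^ n))) by ring.
    assert (0 <= eps * log_jump n) by nra. nra. }
  assert (L2 : Cmod (psum c z - 1) <= eps).
  { assert (S1 : is_Cseries (fun k => (c (S k) * z ^ S k)%C) (psum c z - 1)%C).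
    { apply (is_series_incr_1 (V := C_NormedModule) (fun k => (c k * z ^ k)%C)).
      refine (eq_ind_r (fun l => is_Cseries _ l) (psum_correct c z Hc Hz) _).
      change (psum c z - 1 + 1 * 1 = psum c z)%C. ring. }
    apply (Cmod_series_le_bound _ (fun k => eps * log_jump k) _ _ S1); auto.
    intros n. rewrite Cmod_mult, Cmod_pow. simpl c. rewrite Cmod_R. pose proof (log_jump_bounds n).
    rewrite Rabs_pos_eq by nra.
    assert (Cmod z ^ S n <= 1) by (rewrite <- (pow1 (S n)); apply pow_incr; lra).
    assert (0 <= eps * log_jump n) by nra. nra. }
  assert (L3 : 1 - eps <= Cmod (psum c z)).
  { pose proof (Cmod_triangle (psum c z) (- (psum c z - 1))) as T.
    replace (psum c z + - (psum c z - 1))%C with (RtoC 1) in T by ring.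
    rewrite Cmod_1, Cmod_opp in T. lra. }
  apply Rle_trans with eps; auto.
  replace eps with (eps / (1 - eps) * (1 - eps)) at 1 by (field; lra).
  apply Rmult_le_compat_l; [|lra]. left. apply Rdiv_lt_0_compat; lra.
Qed.

(** At [n = 2^m + 1] the coefficient is [eps / (m (m + 1) n)], while a bound
    [K n^(g - 1)] with [g < 0] would make it smaller than [1 / n] by a factor
    exponential in [m]. *)
Lemma dyadic_growth eps : 0 < eps < 1 ->
  Rbar_le (Finite 0) (growth_exponent (icoef (dyadic_coef eps)) (fun _ => RtoC 0)).
Proof.
  intros He. set (c := dyadic_coef eps).
  apply growth_exponent_ge. intros g K Hg [N HN].
  (* One third of the decay absorbs [K], and two thirds absorb [m (m + 1)]. *)
  set (d := - g / 3). assert (Hd : 0 < d) by (unfold d; lra).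
  assert (Hln2 : 0 < ln 2) by (rewrite <- ln_1; apply ln_increasing; lra).
  set (e := d * ln 2). assert (He' : 0 < e) by now apply Rmult_lt_0_compat.
  destruct (eventually_lt_Rpower (2 * K / (eps * e ^ 2)) d Hd) as [N' HN'].
  set (m := max 1 (max N N')). assert (Hm1 : 1 <= INR m) by (apply (le_INR 1); unfold m; lia).
  assert (Hm : (m < 2 ^ m)%nat) by (apply Nat.pow_gt_lin_r; lia).
  set (k := (2 ^ m - 1)%nat).
  specialize (HN (S (S k)) ltac:(unfold k, m in *; lia)).
  specialize (HN' (S (S k)) ltac:(unfold k, m in *; lia)).
  assert (Hx : 2 ^ m <= INR (S (S k))).
  { replace (2 ^ m) with (INR (2 ^ m)) by (rewrite pow_INR; reflexivity).
    apply le_INR. unfold k. lia. }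
  assert (H2m : 0 < 2 ^ m) by (apply pow_lt; lra).
  assert (Hjump : log_jump k = / (INR m * (INR m + 1))) by (apply log_jump_pow2; unfold m; lia).
  assert (Hj : 0 < log_jump k) by (rewrite Hjump; apply Rinv_0_lt_compat; nra).
  assert (Hcoef : Cmod (icoef c (S (S k))) = eps * log_jump k / INR (S (S k))).
  { unfold icoef, c, dyadic_coef. rewrite <- RtoC_div by lra.
    rewrite Cmod_R, Rabs_pos_eq; auto. left. apply Rdiv_lt_0_compat; nra. }
  rewrite Cmod_0, Rplus_0_r, Hcoef, Hjump in HN.
  set (x := INR (S (S k))) in *. assert (Hx0 : 0 < x) by lra.
  set (y := Rpower x d) in *.
  assert (Hy : e * INR m <= y).
  { apply Rle_trans with (Rpower (2 ^ m) d).
    - rewrite <- Rpower_pow, Rpower_mult by lra. unfold Rpower.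
      pose proof (exp_ineq1_le (INR m * d * ln 2)). unfold e. lra.
    - apply Rle_Rpower_l; [lra|]. lra. }
  assert (Hy0 : 0 < y) by apply exp_pos.
  assert (Ey : x * Rpower x (g - 1) * y ^ 3 = 1).
  { replace (y ^ 3) with (y * y * y) by ring. unfold y.
    replace (x * Rpower x (g - 1)) with (Rpower x 1 * Rpower x (g - 1)) by now rewrite Rpower_1.
    rewrite <- !Rpower_plus. replace (1 + (g - 1) + (d + d + d)) with 0 by (unfold d; field).
    now apply Rpower_O. }
  set (w := Rpower x (g - 1)) in *. assert (Hw : 0 < w) by apply exp_pos.
  assert (H3 : eps * y ^ 3 <= K * (INR m * (INR m + 1))).
  { apply (Rmult_le_compat_r (x * (y ^ 3 * (INR m * (INR m + 1))))) in HN.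
    2: { left. assert (0 < y ^ 3) by now apply pow_lt. repeat apply Rmult_lt_0_compat; lra. }
    replace (eps * / (INR m * (INR m + 1)) / x * (x * (y ^ 3 * (INR m * (INR m + 1)))))
      with (eps * y ^ 3) in HN by (field; lra).
    replace (K * w * (x * (y ^ 3 * (INR m * (INR m + 1)))))
      with (K * (INR m * (INR m + 1)) * (x * w * y ^ 3)) in HN by ring.
    now rewrite Ey, Rmult_1_r in HN. }
  assert (H4 : 2 * K < y * (eps * e ^ 2)).
  { assert (0 < eps * e ^ 2) by (apply Rmult_lt_0_compat; [lra|now apply pow_lt]).
    apply (Rmult_lt_compat_r (eps * e ^ 2)) in HN'; auto.
    replace (2 * K / (eps * e ^ 2) * (eps * e ^ 2)) with (2 * K) in HN' by (field; lra). exact HN'. }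
  assert (H5 : (e * INR m) ^ 2 <= y ^ 2) by (apply pow_incr; nra).
  assert (H6 : eps * y * (e * INR m) ^ 2 <= eps * y * y ^ 2) by (apply Rmult_le_compat_l; nra).
  assert (H7 : 2 * K * (INR m * INR m) < y * (eps * e ^ 2) * (INR m * INR m))
    by (apply Rmult_lt_compat_r; nra).
  assert (HK : 0 < K).
  { apply (Rmult_lt_reg_r (INR m * (INR m + 1))); [nra|]. rewrite Rmult_0_l.
    eapply Rlt_le_trans; [|exact H3]. apply Rmult_lt_0_compat; [lra|now apply pow_lt]. }
  assert (H8 : K * (INR m * (INR m + 1)) <= K * (2 * (INR m * INR m))) by (apply Rmult_le_compat_l; nra).
  nra.
Qed.

Lemma gamma_lower_small lam : 0 < lam -> exists f x, B_H lam f /\ is_gamma f x /\ Rbar_le (Finite 0) x.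
Proof.
  (* chosen so that [eps / (1 - eps) = lam] *)
  intros Hl. set (eps := lam / (1 + lam)).
  assert (He : 0 < eps < 1).
  { unfold eps. split. apply Rdiv_lt_0_compat; lra.
    apply (Rmult_lt_reg_r (1 + lam)); [lra|]. unfold Rdiv. rewrite Rmult_assoc, Rinv_l; lra. }
  destruct (analytic_example (dyadic_coef eps) lam) as [H1 H2]; auto using disk_coeffs_dyadic.
  { intros z Hz. assert (El : lam = eps / (1 - eps)) by (unfold eps; field; lra).
    rewrite El.
    now apply dyadic_pre_Schwarzian. }
  do 2 eexists. split; [exact H1|]. split; [exact H2|]. now apply dyadic_growth.
Qed.

(** * The growth exponent of the class *)

Lemma alpha_le lam : 0 < lam -> alpha lam <= lam ^ 2.
Proof.
  intros H. unfold alpha. assert (sqrt (1 + 4 * lam ^ 2) <= 1 + 2 * lam ^ 2); [|lra].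
  rewrite <- (sqrt_pow2 (1 + 2 * lam ^ 2)) by nra. apply sqrt_le_1; nra.
Qed.

Lemma gamma_class_ge (X : (C -> C) -> Prop) f x : X f -> is_gamma f x -> Rbar_le x (gamma_class X).
Proof.
  intros HX Hx. unfold gamma_class, Rbar_lub.
  destruct (Rbar_ex_lub _) as [l Hl]. simpl. apply (proj1 Hl). eauto.
Qed.

Theorem theorem5p2 :
  (forall lambda : R, 0 < lambda ->
     Rbar_le (Finite (Rmax (lambda - 1) 0)) (gamma_class (B_H lambda)) /\
     Rbar_le (gamma_class (B_H lambda)) (Finite (alpha lambda))) /\
  (exists K : R,
     at_right 0 (fun lambda : R =>
       Rbar_le (Rbar_abs (gamma_class (B_H lambda)))
               (Finite (K * lambda ^ 2)))).
Proof.
  assert (Main : forall lambda : R, 0 < lambda ->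
     Rbar_le (Finite (Rmax (lambda - 1) 0)) (gamma_class (B_H lambda)) /\
     Rbar_le (gamma_class (B_H lambda)) (Finite (alpha lambda))).
  { intros lam Hl. split.
    - destruct (Rle_lt_dec lam 1) as [h|h].
      + rewrite Rmax_right by lra. destruct (gamma_lower_small lam Hl) as [f [x [H1 [H2 H3]]]].
        eapply Rbar_le_trans; [exact H3|]. eapply gamma_class_ge; eauto.
      + rewrite Rmax_left by lra. destruct (gamma_lower_large lam h) as [f [x [H1 [H2 H3]]]].
        eapply Rbar_le_trans; [exact H3|]. eapply gamma_class_ge; eauto.
    - unfold gamma_class, Rbar_lub. destruct (Rbar_ex_lub _) as [l Hl']. simpl.
      apply (proj2 Hl'). intros x [f [H1 H2]]. now apply (gamma_upper_bound lam f). }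
  split; auto. exists 1. exists (mkposreal 1 Rlt_0_1). intros lam _ Hl.
  destruct (Main lam Hl) as [H1 H2].
  assert (H0 := Rmax_r (lam - 1) 0). pose proof (alpha_le lam Hl).
  destruct (gamma_class (B_H lam)) as [v| |]; simpl in *; try easy.
  rewrite Rabs_pos_eq; lra.
Qed.
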